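(* Consider a binary linear code of length $n$ and dimension $k$ (rate $k/n$), whose codewords are chosen uniformly, interleaved, and mapped by an injective labeling of $m$-bit groups onto a $2^m$-ary complex constellation $\mathbb{X}$, yielding $N=n/m$ symbols $X_1,\dots,X_N$ transmitted over the family of memoryless complex AWGN channels $\{\mathrm{AWGN}(h)\}_{h\in[0,m]}$ parameterized by the channel entropy $h$ (with $h=0$ corresponding to a noiseless channel and $h=m$ to a channel whose output carries no information about the input). Let $g(h)$ be the GEXIT function of this system. Then $$\frac{1}{m}\int_0^m g(h)\,\mathrm{d}h=\frac{k}{n}.$$
   Context: Let $\mathbf{Y}=(Y_1,\dots,Y_N)$, where $Y_t=X_t+n_t$ with $n_t$ i.i.d. complex Gaussian noise of variance $\sigma^2$ per real dimension, and the channel parameter $h$ (channel entropy, in bits) is a smooth monotone function of $\sigma$, the family being ordered by physical degradation. The GEXIT function is defined by $g(h)=\frac{1}{N}\sum_{t=1}^N\frac{\mathrm{d}H(X_t\mid\mathbf{Y})}{\mathrm{d}h}$, i.e. the normalized sum over symbols of the derivatives of the per-symbol conditional entropies given the full channel output vector with respect to the common channel parameter $h$ (all individual channels sharing the same parameter $h$). Entropies are in bits.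
   Formalization: In the GEXIT function, each H(X_t|Y) is differentiated only in symbol t's own channel parameter, then all parameters are set to h; differentiating in the common h makes the claim false (length-2 repetition code, m=1: integral 1, not 1/2). *)

(* Defs.v *)
From HB Require Import structures.
From mathcomp Require Import all_boot all_order all_algebra all_fingroup.
From mathcomp Require Import all_classical all_reals all_analysis.
Set Implicit Arguments. Unset Strict Implicit. Unset Printing Implicit Defensive.
Import Order.TTheory GRing.Theory Num.Theory.
Import numFieldNormedType.Exports.
Local Open Scope ring_scope.

(* Complex numbers are represented as pairs (Re, Im) in R * R. *)

(* Double Lebesgue integral over C = R^2 (nonnegative integrands). *)
Definition cint (R : realType) (f : R * R -> \bar R) : \bar R :=
  (\int[@lebesgue_measure R]_a \int[@lebesgue_measure R]_b f (a, b))%E.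

(* Iterated Lebesgue integral over C^n of a function of y : nat -> C
   (only the coordinates y 0, ..., y (n-1) are integrated). *)
Fixpoint iintC (R : realType) (n : nat) (f : (nat -> R * R) -> \bar R)
  : \bar R :=
  match n with
  | 0 => f (fun _ => (0, 0))
  | n'.+1 => cint (fun z => iintC n'
                     (fun v => f (fun i => if i is i'.+1 then v i' else z)))
  end.

Definition gauss (R : realType) (s : R) (z : R * R) : R :=
  (2 * pi * s ^+ 2)^-1 * expR (- (z.1 ^+ 2 + z.2 ^+ 2) / (2 * s ^+ 2)).

Definition csub (R : realType) (y x : R * R) : R * R := (y.1 - x.1, y.2 - x.2).

Definition negxlog2 (R : realType) (u : R) : R :=
  if u == 0 then 0 else - (u * ln u / ln 2).

(* t-th transmitted symbol of codeword c: interleave by pi, group into N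
   blocks of m bits, map each block by the labeling lab. *)
Definition xsym (R : realType) (m N : nat) (lab : 'rV['F_2]_m -> R * R)
  (pi : 'S_(N * m)) (t : 'I_N) (c : 'rV['F_2]_(N * m)) : R * R :=
  lab (row t (vec_mx (col_perm pi c))).

Definition lik (R : realType) (m N : nat) (lab : 'rV['F_2]_m -> R * R)
  (pi : 'S_(N * m)) (s : 'I_N -> R) (c : 'rV['F_2]_(N * m))
  (y : nat -> R * R) : R :=
  \prod_(t < N) gauss (s t) (csub (y t) (xsym lab pi t c)).

Definition liksum (R : realType) (m N : nat) (C : {vspace 'rV['F_2]_(N * m)})
  (lab : 'rV['F_2]_m -> R * R) (pi : 'S_(N * m)) (s : 'I_N -> R)
  (y : nat -> R * R) : R :=
  \sum_(c : 'rV['F_2]_(N * m) | c \in C) lik lab pi s c y.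

Definition pY (R : realType) (m N : nat) (C : {vspace 'rV['F_2]_(N * m)})
  (lab : 'rV['F_2]_m -> R * R) (pi : 'S_(N * m)) (s : 'I_N -> R)
  (y : nat -> R * R) : R :=
  (#|[pred c : 'rV['F_2]_(N * m) | c \in C]|%:R)^-1 * liksum C lab pi s y.

Definition post (R : realType) (m N : nat) (C : {vspace 'rV['F_2]_(N * m)})
  (lab : 'rV['F_2]_m -> R * R) (pi : 'S_(N * m)) (s : 'I_N -> R)
  (t : 'I_N) (b : 'rV['F_2]_m) (y : nat -> R * R) : R :=
  (\sum_(c : 'rV['F_2]_(N * m) | (c \in C) && (xsym lab pi t c == lab b))
      lik lab pi s c y) / liksum C lab pi s y.

Definition Hsym (R : realType) (m N : nat) (C : {vspace 'rV['F_2]_(N * m)})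
  (lab : 'rV['F_2]_m -> R * R) (pi : 'S_(N * m)) (s : 'I_N -> R)
  (t : 'I_N) : R :=
  fine (iintC N (fun y => (pY C lab pi s y *
          \sum_(b : 'rV['F_2]_m) negxlog2 (post C lab pi s t b y))%:E)).

(* Channel entropy of AWGN with noise std sigma: H(X|Y) in bits for X
   uniform on the constellation lab @ {0,1}^m, single channel use. *)
Definition hchan (R : realType) (m : nat) (lab : 'rV['F_2]_m -> R * R)
  (sigma : R) : R :=
  fine (cint (fun z =>
    (((2 ^ m)%:R)^-1 * (\sum_(b : 'rV['F_2]_m) gauss sigma (csub z (lab b))) *
     \sum_(b : 'rV['F_2]_m) negxlog2 (gauss sigma (csub z (lab b)) /
        \sum_(b' : 'rV['F_2]_m) gauss sigma (csub z (lab b'))))%:E)).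

(* GEXIT function: g(h) = 1/N sum_t d H(X_t|Y) / d h_t at h_1=...=h_N=h,
   where sig maps channel entropy to noise std. *)
Definition gexit (R : realType) (m N : nat) (C : {vspace 'rV['F_2]_(N * m)})
  (lab : 'rV['F_2]_m -> R * R) (pi : 'S_(N * m)) (sig : R -> R) (h : R) : R :=
  (N%:R)^-1 * \sum_(t < N)
     derive1 (fun u : R => Hsym C lab pi
                 (fun s : 'I_N => if s == t then sig u else sig h) t) h.

(* Main.v *)
Require Import Defs.
From HB Require Import structures.
From mathcomp Require Import all_boot all_order all_algebra all_fingroup.
From mathcomp Require Import finfield all_classical all_reals all_analysis.
From mathcomp Require Import measurable_realfun lebesgue_integral_under ring lra.
Import Order.TTheory GRing.Theory Num.Theory.
Import numFieldNormedType.Exports.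
Local Open Scope ring_scope.
Local Open Scope classical_set_scope.

(* Rescaling each real coordinate of the output by the noise deviation turns
   both H(X|Y) and the entropy of the single channel into averages, over
   standard Gaussian noise z, of logarithms of sums of likelihood ratios
   exp(-sum_k (a_k z_k D_k + a_k^2 D_k^2 / 2)), where D is a difference of two
   transmitted points and a_k is the inverse noise deviation in coordinate k.
   Gaussian integration by parts shows that the derivative of such an average
   in a_k is -a_k times a mean squared error.  The partial derivative of
   H(X_t|Y) in the parameter of symbol t is that of H(X|Y), because
   H(X|X_t,Y) does not depend on that parameter; hence N g(h) is the total
   derivative of H(X|Y) along the diagonal.  It is nonnegative and continuous
   in ]0, m[, since the channel entropy is strictly decreasing in 1/sigma with
   a nonvanishing derivative, so the integral of N g is the difference of
   H(X|Y) between a useless channel (k bits) and a noiseless one (0). *)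

(** * Tame functions of infinitely many real variables *)

(** In [gexit], the summand of symbol t differentiates H(X_t|Y) in the noise of symbol t alone, the
    other channels being frozen at [sig h]. The value k/n rests on this: if all channels moved
    together, the integral of the sum would be the sum of the entropies H(X_t), whereas these
    partial derivatives add up to the derivative of the joint H(X|Y).

    Rescaling fixes the integration measure and moves the noise level into the integrand; the
    useless channel, at infinite deviation, becomes the regular point a = 0. The level is stored as
    one more coordinate, just after the averaged ones, so that a single lemma on differentiation
    under the integral serves both noise and parameter.

    [sig] is given only as a right inverse of the channel entropy on ]0, m[, so its
    differentiability has to come from the inverse function theorem; strict positivity of the mean
    squared error of the constellation is what makes that theorem apply. The integrand is arbitrary
    at 0 and m; inside, its sign lets monotone convergence extend the area from compact
    subintervals. *)

Section PointwiseDerive.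
Context {R : realType}.
Implicit Types (f g : R -> R) (x df dg : R).

Lemma is_derive_addf f g x df dg : is_derive x (1 : R) f df ->
  is_derive x (1 : R) g dg -> is_derive x (1 : R) (fun y => f y + g y) (df + dg).
Proof. exact: is_deriveD. Qed.

Lemma is_derive_mulf f g x df dg : is_derive x (1 : R) f df ->
  is_derive x (1 : R) g dg ->
  is_derive x (1 : R) (fun y => f y * g y) (df * g x + f x * dg).
Proof.
move=> fx gx; have -> : (fun y => f y * g y) = f * g by [].
by apply: is_derive_eq; rewrite addrC [df * _]mulrC.
Qed.

Lemma is_derive_sumf (I : Type) (r : seq I) (P : pred I) (F : I -> R -> R)
    (dF : I -> R) x : (forall i, P i -> is_derive x (1 : R) (F i) (dF i)) ->
  is_derive x (1 : R) (fun y => \sum_(i <- r | P i) F i y) (\sum_(i <- r | P i) dF i).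
Proof.
move=> FdF; elim: r => [|i r IH].
  rewrite big_nil; under eq_fun do rewrite big_nil.
  exact: is_derive_cst.
rewrite big_cons; under eq_fun do rewrite big_cons.
by case: ifPn => // Pi; apply: is_derive_addf => //; exact: FdF.
Qed.

Lemma is_derive_compf f g x df dg : is_derive x (1 : R) f df ->
  is_derive (f x) (1 : R) g dg -> is_derive x (1 : R) (fun y => g (f y)) (dg * df).
Proof.
move=> fx gfx; exact: is_derive1_comp.
Qed.

End PointwiseDerive.

Section Tame.
Context {R : realType}.
Implicit Types (f g : (nat -> R) -> R) (u v : nat -> R) (c : nat).

Lemma cvg_bigsum (I : Type) (r : seq I) (P : pred I) (x : I -> nat -> R)
    (l : I -> R) : (forall i, P i -> x i n @[n --> \oo] --> l i) ->
  \sum_(i <- r | P i) x i n @[n --> \oo] --> \sum_(i <- r | P i) l i.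
Proof.
move=> xl; elim: r => [|i r IH].
  rewrite big_nil; under eq_fun do rewrite big_nil.
  exact: cvg_cst.
rewrite big_cons; under eq_fun do rewrite big_cons.
by case: ifPn => // /xl xli; exact: cvgD.
Qed.

Definition scons (z : R) (v : nat -> R) : nat -> R :=
  fun i => if i is j.+1 then v j else z.

(** Continuity for pointwise convergence, stated on sequences because that is the form which
    dominated convergence carries through an integral. *)
Definition seqcont f := forall (u : nat -> nat -> R) v,
  (forall i, u n i @[n --> \oo] --> v i) -> f (u n) @[n --> \oo] --> f v.

(** One number governs the constant, the exponential rate and the number of coordinates involved, so
    that products just add these numbers; the summand 1 absorbs constants. *)
Definition growth c v : R := expR (c%:R * (1 + \sum_(i < c) `|v i|)).

(* Tame functions are stable under Gaussian averaging of a coordinate, which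
   makes every iterated expectation below converge. *)
Definition tame f := seqcont f /\ exists c, forall v, `|f v| <= growth c v.

Lemma growth_ge1 c v : 1 <= growth c v.
Proof.
by rewrite -[leLHS]expR0 ler_expR mulr_ge0// addr_ge0// sumr_ge0.
Qed.

Lemma growthM c d v : growth c v * growth d v <= growth (c + d) v.
Proof.
rewrite -expRD ler_expR natrD mulrDl; apply: lerD; rewrite ler_wpM2l// lerD2l.
  by rewrite big_split_ord/= lerDl sumr_ge0.
by rewrite addnC big_split_ord/= lerDl sumr_ge0.
Qed.

Lemma growthDl c d v : growth c v <= growth (c + d) v.
Proof.
by apply: le_trans (growthM c d v); rewrite ler_peMr ?growth_ge1// expR_ge0.
Qed.

Lemma growthDr c d v : growth d v <= growth (c + d) v.
Proof. by rewrite addnC growthDl. Qed.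

Lemma growth_cst (x : R) : exists c, forall v, `|x| <= growth c v.
Proof.
exists (Num.bound x) => v; rewrite /growth.
apply: (le_trans (ltW (archi_boundP (normr_ge0 x)))).
rewrite /Num.bound normr_id -/(Num.bound x).
apply: (le_trans _ (expR_ge1Dx _)).
rewrite -[leLHS]add0r lerD// ler_peMr// lerDl; exact: sumr_ge0.
Qed.

Lemma tame_le f g : seqcont f -> tame g -> (forall v, `|f v| <= `|g v|) -> tame f.
Proof.
move=> cf [_ [c gc]] fg; split=> //; exists c => v.
exact: le_trans (fg v) (gc v).
Qed.

Lemma tame_cst (x : R) : tame (fun _ => x).
Proof.
by split; [move=> u v _; exact: cvg_cst|exact: growth_cst].
Qed.

Lemma tameD f g : tame f -> tame g -> tame (fun v => f v + g v).
Proof.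
move=> [cf [c fc]] [cg [d gd]]; split=> [u v uv|].
  by apply: cvgD; [exact: cf|exact: cg].
have [e he] := growth_cst 2.
exists (e + (c + d))%N => v; apply: le_trans (growthM _ _ _).
apply: (@le_trans _ _ (2 * growth (c + d) v)); last first.
  by rewrite ler_wpM2r ?expR_ge0// (le_trans (ler_norm _)).
rewrite mulr_natl mulr2n (le_trans (ler_normD _ _))// lerD//.
  exact: le_trans (fc v) (growthDl _ _ _).
exact: le_trans (gd v) (growthDr _ _ _).
Qed.

Lemma tameM f g : tame f -> tame g -> tame (fun v => f v * g v).
Proof.
move=> [cf [c fc]] [cg [d gd]]; split=> [u v uv|].
  by apply: cvgM; [exact: cf|exact: cg].
exists (c + d)%N => v; apply: le_trans (growthM _ _ _).
by rewrite normrM ler_pM.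
Qed.

Lemma tame_proj k : tame (fun v => v k).
Proof.
split=> [u v uv|]; first exact: uv.
exists k.+1 => v; apply: le_trans (ler_norm _) _.
rewrite normr_id; apply: (le_trans _ (expR_ge1Dx _)).
rewrite big_ord_recr/=.
set S := \sum_(i < k) _; have S0 : 0 <= S by exact: sumr_ge0.
have := normr_ge0 (v k); have : 0 <= k%:R :> R by [].
rewrite -natr1; nra.
Qed.

Lemma tameN f : tame f -> tame (fun v => - f v).
Proof.
move=> tf; have := tameM _ _ (tame_cst (-1)) tf.
by under eq_fun do rewrite mulN1r.
Qed.

Lemma tameB f g : tame f -> tame g -> tame (fun v => f v - g v).
Proof. by move=> tf tg; apply: tameD => //; exact: tameN. Qed.

Lemma tameX f k : tame f -> tame (fun v => f v ^+ k).
Proof.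
move=> tf; elim: k => [|k IH].
  have -> : (fun v => f v ^+ 0) = fun=> 1 by apply/funext => v; rewrite expr0.
  exact: tame_cst.
have -> : (fun v => f v ^+ k.+1) = (fun v => f v * f v ^+ k).
  by apply/funext => v; rewrite exprS.
exact: tameM.
Qed.

Lemma tame_norm f : tame f -> tame (fun v => `|f v|).
Proof.
move=> [cf [c fc]]; split=> [u v uv|]; last by exists c => v; rewrite normr_id.
by apply: cvg_norm; exact: cf.
Qed.

Lemma tame_sum (I : Type) (r : seq I) (P : pred I) (F : I -> (nat -> R) -> R) :
  (forall i, P i -> tame (F i)) -> tame (fun v => \sum_(i <- r | P i) F i v).
Proof.
move=> tF; elim: r => [|i r IH].
  by rewrite (_ : (fun _ => _) = fun=> 0);
    [exact: tame_cst|apply/funext => v; rewrite big_nil].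
have -> : (fun v => \sum_(j <- i :: r | P j) F j v) =
    (fun v => (if P i then F i v else 0) + \sum_(j <- r | P j) F j v).
  by apply/funext => v; rewrite big_cons; case: ifP => // _; rewrite add0r.
apply: tameD => //.
by have := tF i; case: (P i) => [/(_ erefl)|_] //; exact: tame_cst.
Qed.

End Tame.

(** * Gaussian expectation *)

Section GaussianExpectation.
Context {R : realType}.
Notation mu := (@lebesgue_measure R).
Implicit Types (f g : (nat -> R) -> R) (u v : nat -> R) (c : nat).

Notation gam := (normal_pdf (0 : R) 1).

(* Coordinate 0 is averaged out and the others are shifted down, so that
   [iter d gE] averages the first d coordinates, innermost first. *)
Definition gE f v : R := \int[mu]_z (f (scons z v) * gam z).

Lemma gam_ge0 z : 0 <= gam z. Proof. exact: normal_pdf_ge0. Qed.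

Lemma continuous_gam : continuous gam.
Proof. by apply: continuous_normal_pdf; rewrite oner_eq0. Qed.

Lemma seqcont_continuous (h : R -> R) :
  (forall (x : nat -> R) l, x n @[n --> \oo] --> l ->
     h (x n) @[n --> \oo] --> h l) -> continuous h.
Proof. by move=> ch l; apply/(@cvg_nbhsP _ R^o) => x /ch. Qed.

Lemma continuous_seq (h : R -> R) (x : nat -> R) l :
  {for l, continuous h} -> x n @[n --> \oo] --> l ->
  h (x n) @[n --> \oo] --> h l.
Proof. by move=> /(@cvg_nbhsP _ R^o) ch; exact: ch. Qed.

Lemma scons_cvg (x : nat -> R) l (w : nat -> nat -> R) v :
  x n @[n --> \oo] --> l -> (forall i, w n i @[n --> \oo] --> v i) ->
  forall i, scons (x n) (w n) i @[n --> \oo] --> scons l v i.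
Proof. by move=> xl wv [|i] //=; exact: wv. Qed.

Lemma tame_slice_continuous f v : tame f -> continuous (fun z => f (scons z v)).
Proof.
move=> [cf _]; apply: seqcont_continuous => x l xl; apply: cf.
by apply: scons_cvg => // i; exact: cvg_cst.
Qed.

(** A new coordinate costs a factor independent of v, which serves as dominating function for every
    Gaussian average. *)
Lemma growth_scons c z v :
  growth c (scons z v) <= growth c v * expR (c%:R * `|z|).
Proof.
rewrite -expRD ler_expR -mulrDr ler_wpM2l// -addrA lerD2l.
case: c => [|c]; first by rewrite !big_ord0 add0r normr_ge0.
rewrite big_ord_recl/= addrC; apply: lerD => //.
by rewrite [leRHS]big_ord_recr/= lerDl.
Qed.

Lemma seqcont_growth c : seqcont (growth c : (nat -> R) -> R).
Proof.
move=> w v wv; apply: continuous_seq; first exact: continuous_expR.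
apply: cvgM; first exact: cvg_cst.
apply: cvgD; first exact: cvg_cst.
apply: cvg_bigsum => i _; apply: cvg_norm; exact: wv.
Qed.

Lemma growth_seq_bounded c (w : nat -> nat -> R) v :
  (forall i, w n i @[n --> \oo] --> v i) ->
  exists2 K : R, 0 <= K & forall n, growth c (w n) <= K.
Proof.
move=> /(seqcont_growth c) h.
have /cvg_seq_bounded/bounded_fun_has_ubound[K Kub] : cvgn (fun n => growth c (w n)).
  by apply/cvg_ex; exists (growth c v).
have ub n : growth c (w n) <= K by apply: Kub; exists n.
by exists K => //; apply: le_trans (ub 0%N); exact: expR_ge0.
Qed.

Lemma expgam_integrable c :
  mu.-integrable setT (EFin \o (fun z => expR (c%:R * `|z|) * gam z)).
Proof.
have s2 : Num.sqrt 2 != 0 :> R by rewrite gt_eqF// sqrtr_gt0.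
(* With t = |z|, c t - t^2/2 <= c^2 - t^2/4 because (t/2 - c)^2 >= 0: a normal density of variance 2
   dominates, and [K] also exchanges the two peaks. *)
pose K : R := expR (c%:R ^+ 2) * normal_peak 1 / normal_peak (Num.sqrt 2).
apply: (@le_integrable _ _ _ mu setT measurableT _
   (fun z => K%:E * (normal_pdf 0 (Num.sqrt 2) z)%:E)%E).
- apply/measurable_EFinP; apply: continuous_measurable_fun => z.
  apply: cvgM; last exact: continuous_gam.
  apply: (cvg_comp (fun z => c%:R * `|z|) expR); last exact: continuous_expR.
  by apply: cvgM; [exact: cvg_cst|exact: (@norm_continuous _ R^o)].
- move=> z _; rewrite /= lee_fin.
  have p1 := normal_peak_ge0 (1 : R).
  rewrite [leLHS]ger0_norm ?mulr_ge0 ?expR_ge0 ?normal_pdf_ge0//.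
  rewrite [leRHS]ger0_norm ?mulr_ge0 ?expR_ge0 ?invr_ge0 ?normal_peak_ge0 ?normal_pdf_ge0//.
  rewrite !normal_pdfE ?oner_eq0// /K.
  have p2 : normal_peak (Num.sqrt 2) != 0 :> R by rewrite gt_eqF// normal_peak_gt0.
  rewrite -!mulrA (mulKf p2).
  rewrite mulrCA [leRHS]mulrCA ler_wpM2l// -!expRD ler_expR !subr0.
  rewrite expr1n sqr_sqrtr// -(real_normK (num_real z)).
  have := normr_ge0 z; set t := `|z| => t0.
  have -> : - t ^+ 2 / (1 *+ 2) = - (t ^+ 2 / 2) by rewrite mulNr.
  have -> : - t ^+ 2 / (2 *+ 2) = - (t ^+ 2 / 4) by rewrite mulNr -mulr_natr -natrM.
  have := sqr_ge0 (t / 2 - c%:R); nra.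
- by apply: integrableZl => //; exact: integrable_normal_pdf.
Qed.

Lemma dominated_integrable_gam (h : R -> R) (K : R) c : measurable_fun setT h ->
  (forall z, `|h z| <= K * expR (c%:R * `|z|)) ->
  mu.-integrable setT (EFin \o (fun z => h z * gam z)).
Proof.
move=> mh hK.
apply: (@le_integrable _ _ _ mu setT measurableT _
   (fun z => K%:E * (expR (c%:R * `|z|) * gam z)%:E)%E).
- by apply/measurable_EFinP; apply: measurable_funM => //; exact: measurable_normal_pdf.
- move=> z _; rewrite /= lee_fin mulrA normrM [leRHS]normrM ler_wpM2r//.
  by apply: le_trans (hK z) _; exact: ler_norm.
- by apply: integrableZl => //; exact: expgam_integrable.
Qed.

Lemma gaussian_dct (F : nat -> R -> R) (G : R -> R) (K : R) c :
  (forall n, measurable_fun setT (F n)) ->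
  (forall z, F n z @[n --> \oo] --> G z) ->
  (forall n z, `|F n z| <= K * expR (c%:R * `|z|)) ->
  \int[mu]_z (F n z * gam z) @[n --> \oo] --> \int[mu]_z (G z * gam z).
Proof.
move=> mF FG FK.
have mFg n : measurable_fun setT (fun z => (F n z * gam z)%:E).
  apply/measurable_EFinP; apply: measurable_funM => //.
  exact: measurable_normal_pdf.
have mGg : measurable_fun setT (fun z => (G z * gam z)%:E).
  apply/measurable_EFinP; apply: measurable_funM; last exact: measurable_normal_pdf.
  by apply: (measurable_fun_cvg mF) => z _; exact: FG.
have cvFG : {ae mu, forall z, setT z ->
    (F n z * gam z)%:E @[n --> \oo] --> (G z * gam z)%:E}.
  apply: aeW => z _; apply: cvg_EFin; first exact: nearW.
  by apply: cvgM; [exact: FG|exact: cvg_cst].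
have iK : mu.-integrable setT (fun z => K%:E * (expR (c%:R * `|z|) * gam z)%:E)%E.
  by apply: integrableZl => //; exact: expgam_integrable.
have bF : {ae mu, forall z n, setT z ->
    (`|(F n z * gam z)%:E| <= K%:E * (expR (c%:R * `|z|) * gam z)%:E)%E}.
  apply: aeW => z n _; rewrite /= lee_fin mulrA normrM (ger0_norm (gam_ge0 z)).
  by rewrite ler_wpM2r ?gam_ge0.
have [iG _ cG] := @dominated_convergence _ _ _ mu setT measurableT _ _ _ mFg mGg cvFG iK bF.
by apply: fine_cvg; rewrite fineK//; exact: integrable_fin_num.
Qed.

End GaussianExpectation.

Section GaussianExpectationTheory.
Context {R : realType}.
Notation mu := (@lebesgue_measure R).
Notation gam := (normal_pdf (0 : R) 1).
Implicit Types (f g : (nat -> R) -> R) (u v : nat -> R) (c : nat).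

Lemma tame_slice_bound f c v : (forall v, `|f v| <= growth c v) ->
  forall z, `|f (scons z v)| <= growth c v * expR (c%:R * `|z|).
Proof. by move=> fc z; exact: le_trans (fc _) (growth_scons _ _ _). Qed.

Lemma measurable_tame_slice f v : tame f ->
  measurable_fun setT (fun z => f (scons z v)).
Proof.
by move=> tf; apply: continuous_measurable_fun; exact: tame_slice_continuous.
Qed.

Lemma gE_integrable f v : tame f ->
  mu.-integrable setT (EFin \o (fun z => f (scons z v) * gam z)).
Proof.
move=> tf; have [_ [c fc]] := tf.
apply: (@dominated_integrable_gam _ _ (growth c v) c).
  exact: measurable_tame_slice.
exact: tame_slice_bound.
Qed.

Lemma seqcont_gE f : tame f -> seqcont (gE f).
Proof.
move=> tf w v wv; have [cf [c fc]] := tf.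
have [K K0 wK] := growth_seq_bounded c w v wv.
apply: (@gaussian_dct _ _ _ K c).
- by move=> n; exact: measurable_tame_slice.
- move=> z; apply: cf; apply: scons_cvg; [exact: cvg_cst|exact: wv].
- move=> n z; apply: le_trans (tame_slice_bound _ _ _ fc z) _.
  by rewrite ler_wpM2r ?expR_ge0.
Qed.

(** The new number depends on c alone, so a whole sequence of functions keeps a common bound under
    averaging. *)
Lemma gE_growth c : exists c', forall f, tame f ->
  (forall v, `|f v| <= growth c v) -> forall v, `|gE f v| <= growth c' v.
Proof.
have [e Me] := growth_cst (\int[mu]_z (expR (c%:R * `|z|) * gam z)).
exists (e + c)%N => f tf fc v; apply: le_trans (growthM _ _ _).
apply: (le_trans (le_normr_Rintegral _ (gE_integrable f v tf))) => //.
rewrite [leRHS]mulrC; apply: (@le_trans _ _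
  (\int[mu]_z (growth c v * (expR (c%:R * `|z|) * gam z)))).
  apply: le_Rintegral => //.
  - apply: (@le_integrable _ _ _ mu setT measurableT _ _ _ _ (gE_integrable f v tf)).
      apply/measurable_EFinP/measurableT_comp => //.
      by apply: measurable_funM; [exact: measurable_tame_slice|exact: measurable_normal_pdf].
    by move=> z _; rewrite /= normr_id.
  - rewrite /comp; under eq_fun do rewrite EFinM.
    by apply: integrableZl => //; exact: expgam_integrable.
  move=> z _; rewrite normrM (ger0_norm (gam_ge0 z)) mulrA ler_wpM2r ?gam_ge0//.
  exact: tame_slice_bound.
rewrite RintegralZl//; last exact: expgam_integrable.
by rewrite ler_wpM2l ?expR_ge0// (le_trans (ler_norm _)).
Qed.

Lemma tame_gE f : tame f -> tame (gE f).
Proof.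
move=> tf; split; first exact: seqcont_gE.
have [_ [c fc]] := tf; have [c' h] := gE_growth c.
by exists c' => v; exact: h.
Qed.

Lemma gED f g v : tame f -> tame g ->
  gE (fun v => f v + g v) v = gE f v + gE g v.
Proof.
move=> tf tg; rewrite /gE -RintegralD//; [|exact: gE_integrable..].
by apply: eq_Rintegral => z _; rewrite mulrDl.
Qed.

Lemma gEZ (h : (nat -> R) -> R) f v : tame f ->
  gE (fun v => h (fun i => v i.+1) * f v) v = h v * gE f v.
Proof.
move=> tf; rewrite /gE -RintegralZl//; last exact: gE_integrable.
by apply: eq_Rintegral => z _; rewrite mulrA.
Qed.

Lemma gE_shift (h : (nat -> R) -> R) v : gE (fun v => h (fun i => v i.+1)) v = h v.
Proof.
have := gEZ h _ v (tame_cst 1).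
have -> : gE (fun=> 1) v = 1.
  rewrite /gE; under eq_Rintegral do rewrite mul1r.
  by rewrite /Rintegral integral_normal_pdf.
rewrite mulr1 => <-; congr gE; by apply/funext => ?; rewrite mulr1.
Qed.

Lemma gE_le f g v : tame f -> tame g -> (forall v, f v <= g v) ->
  gE f v <= gE g v.
Proof.
move=> tf tg fg; apply: le_Rintegral => //; [exact: gE_integrable..|].
by move=> z _; rewrite ler_wpM2r ?gam_ge0.
Qed.

Definition upd v k (y : R) : nat -> R := fun i => if i == k then y else v i.

Definition is_pderive k f g :=
  forall v (x : R), is_derive x (1 : R) (fun y => f (upd v k y)) (g (upd v k x)).

Lemma updE v k y : upd v k y k = y.
Proof. by rewrite /upd eqxx. Qed.

Lemma scons_upd z v k y : scons z (upd v k y) = upd (scons z v) k.+1 y.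
Proof. by apply/funext => -[|i]. Qed.

Lemma growth_upd c v k x y : `|x| <= `|y| -> growth c (upd v k x) <= growth c (upd v k y).
Proof.
move=> xy; rewrite ler_expR ler_wpM2l// lerD2l; apply: ler_sum => i _.
by rewrite /upd; case: ifP.
Qed.

Lemma is_pderive_gE k f g : tame f -> tame g ->
  is_pderive k.+1 f g -> is_pderive k (gE f) (gE g).
Proof.
move=> tf tg dfg v x.
pose F (y z : R) := f (scons z (upd v k y)) * gam z.
have dF (y z : R) : is_derive y (1 : R) (F ^~ z) (g (scons z (upd v k y)) * gam z).
  rewrite /F; have := dfg (scons z v) y.
  under eq_fun do rewrite -scons_upd.
  rewrite -scons_upd => dfz.
  apply: (is_derive_eq
    (is_derive_mulf _ _ _ _ _ dfz (is_derive_cst (gam z) y (1 : R)))).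
  by rewrite mulr0 addr0.
have d1F (y z : R) : partial1of2 F y z = g (scons z (upd v k y)) * gam z.
  by rewrite partial1of2E; exact: derive_val.
have [_ [c gc]] := tg.
(* On ]x - 1, x + 1[ coordinate k is at most |x| + 1 in absolute value and [growth] is monotone in
   absolute values: the bound is uniform in y. *)
pose G z := growth c (upd v k (`|x| + 1)) * (expR (c%:R * `|z|) * gam z).
have xx : `]x - 1, x + 1[ x by rewrite /= in_itv/= gtrBl ltrDl ltr01.
have iF (y : R) : `]x - 1, x + 1[ y -> mu.-integrable setT (EFin \o F y).
  by move=> _; exact: gE_integrable.
have derF (y z : R) : `]x - 1, x + 1[ y -> setT z -> derivable (F ^~ z) y 1.
  by move=> _ _; exact: ex_derive.
have G0 z : 0 <= G z by rewrite !mulr_ge0 ?expR_ge0 ?gam_ge0.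
have iG : mu.-integrable setT (EFin \o G).
  rewrite /G /comp; under eq_fun do rewrite EFinM.
  by apply: integrableZl => //; exact: expgam_integrable.
have Gub (y z : R) : `]x - 1, x + 1[ y -> setT z -> `|partial1of2 F y z| <= G z.
  rewrite /= in_itv/= => /andP[xy yx] _.
  rewrite d1F normrM (ger0_norm (gam_ge0 z)) /G mulrA ler_wpM2r ?gam_ge0//.
  apply: le_trans (tame_slice_bound _ _ _ gc z) _.
  rewrite ler_wpM2r ?expR_ge0// growth_upd// [leRHS]ger0_norm ?addr_ge0//.
  rewrite ler_norml; have := ler_norm x; have := ler_norm (- x).
  by rewrite normrN; lra.
have E := differentiation_under_integral measurableT xx iF derF G0 iG Gub.
have D := derivable_under_integral measurableT xx iF derF G0 iG Gub.
apply: DeriveDef; first exact: D.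
rewrite -derive1E [LHS]E; apply: eq_Rintegral => z _; exact: d1F.
Qed.

End GaussianExpectationTheory.

(** * Gaussian integration by parts *)

Section Stein.
Context {R : realType}.
Notation mu := (@lebesgue_measure R).
Notation gam := (normal_pdf (0 : R) 1).
Implicit Types (f g : (nat -> R) -> R) (u v : nat -> R) (c : nat).

Lemma gamE z : gam z = normal_peak 1 * expR (- (z ^+ 2 / 2)).
Proof.
by rewrite normal_pdfE ?oner_eq0// /normal_fun subr0 expr1n mulNr.
Qed.

Lemma is_derive_gam (z : R) : is_derive z (1 : R) gam (- z * gam z).
Proof.
have -> : gam = (fun z => normal_peak 1 * expR (- (z ^+ 2 / 2))).
  by apply/funext => y; rewrite gamE.
have d2 : is_derive z (1 : R) (fun y : R => - 2^-1 * (y * y)) (- z).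
  apply: (is_derive_eq (is_derive_mulf _ _ _ _ _ (is_derive_cst (- 2^-1 : R) z (1 : R))
    (is_derive_mulf _ _ _ _ _ (is_derive_id z (1 : R)) (is_derive_id z (1 : R))))).
  by rewrite /=; field.
have -> : (fun y : R => normal_peak 1 * expR (- (y ^+ 2 / 2))) =
    (fun y : R => normal_peak 1 * expR (- 2^-1 * (y * y))).
  by apply/funext => y; congr (_ * expR _); field.
apply: (is_derive_eq (is_derive_mulf _ _ _ _ _
  (is_derive_cst (normal_peak 1 : R) z (1 : R))
  (is_derive_compf _ _ _ _ _ d2 (is_derive_expR _)))).
have -> : - 2^-1 * (z * z) = - (z ^+ 2 / 2) by field.
by rewrite /=; ring.
Qed.

Lemma expgam_cvg0 c :
  expR (c%:R * n.+1%:R) * gam n.+1%:R @[n --> \oo] --> (0 : R).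
Proof.
(* c t - t^2/2 <= (c + 1)^2/2 - t because (c + 1 - t)^2 >= 0; then exp(-t) <= 1/t. *)
pose K : R := normal_peak 1 * expR ((c%:R + 1) ^+ 2 / 2).
apply: (@squeeze_cvgr _ _ _ _ (cst 0) (fun n => K * n.+1%:R^-1)).
- near=> n; rewrite /= mulr_ge0 ?expR_ge0 ?gam_ge0//=.
  rewrite gamE mulrCA /K -[X in _ <= X]mulrA ler_wpM2l ?normal_peak_ge0//.
  have n0 : 0 <= n.+1%:R :> R by [].
  apply: (@le_trans _ _ (expR ((c%:R + 1) ^+ 2 / 2) * expR (- n.+1%:R))).
    rewrite -!expRD ler_expR; have := sqr_ge0 (c%:R + 1 - n.+1%:R : R); lra.
  rewrite ler_wpM2l ?expR_ge0// expRN lef_pV2 ?posrE ?expR_gt0//.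
  by apply: le_trans (expR_ge1Dx _); rewrite lerDr.
- exact: cvg_cst.
- rewrite -(mulr0 K); apply: cvgM; first exact: cvg_cst.
  exact: cvg_harmonic.
Unshelve. all: by end_near. Qed.

(** The integrand is the derivative of h times the density, whose own derivative is -z times itself;
    the boundary terms vanish because exponential growth loses to the Gaussian. *)
Lemma integral_derive_gam (h dh : R -> R) (K : R) c : 
  (forall x : R, is_derive x (1 : R) h (dh x)) -> continuous dh ->
  (forall z, `|h z| <= K * expR (c%:R * `|z|)) ->
  (forall z, `|dh z - z * h z| <= K * expR (c%:R * `|z|)) ->
  \int[mu]_z ((dh z - z * h z) * gam z) = 0.
Proof.
move=> hdh cdh hK dK.
have ch : continuous h.
  by move=> x; apply/differentiable_continuous/derivable1_diffP; exact: ex_derive.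
pose k z := (dh z - z * h z) * gam z.
pose H z := h z * gam z.
have HK z : is_derive z (1 : R) H (k z).
  apply: (is_derive_eq (is_derive_mulf _ _ _ _ _ (hdh z) (is_derive_gam z))).
  by rewrite /k; ring.
have cH : continuous H.
  by move=> x; apply/differentiable_continuous/derivable1_diffP; exact: ex_derive.
have ck : continuous k.
  move=> x; apply: cvgM; last exact: continuous_gam.
  by apply: cvgB; [exact: cdh|apply: cvgM; [exact: cvg_id|exact: ch]].
pose D (n : nat) : set R := `[- n.+1%:R, n.+1%:R].
have D0 n : (- n.+1%:R < n.+1%:R :> R) by rewrite gtrN ?ltr0n.
(* The truncation enters the integrand as an indicator, so that dominated convergence applies on the
   whole line. *)
have I1 n : \int[mu]_z ((\1_(D n) z * (dh z - z * h z)) * gam z) =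
    H n.+1%:R - H (- n.+1%:R).
  have := @continuous_FTC2 R k H _ _ (D0 n).
  rewrite /Rintegral => E.
  transitivity (fine (\int[mu]_(x in `[(- n.+1%:R)%R, n.+1%:R]) (k x)%:E)%E).
    rewrite [in RHS]integral_mkcond/=; congr fine; apply: eq_integral => z _.
    by rewrite patchE indicE /D; case: ifPn => zD; rewrite /k ?mul1r ?mul0r.
  rewrite E//.
  - exact: continuous_subspaceT.
  - split => [z _||].
    + exact: ex_derive.
    + by apply: cvg_at_right_filter; exact: cH.
    + by apply: cvg_at_left_filter; exact: cH.
  - by move=> z _; rewrite derive1E; exact: derive_val.
have l1 : \int[mu]_z ((\1_(D n) z * (dh z - z * h z)) * gam z) @[n --> \oo]
    --> \int[mu]_z ((dh z - z * h z) * gam z).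
  apply: (@gaussian_dct _ _ _ K c).
  - move=> n; apply: measurable_funM; first by apply: measurable_indic; exact: measurable_itv.
    apply: continuous_measurable_fun => x.
    by apply: cvgB; [exact: cdh|apply: cvgM; [exact: cvg_id|exact: ch]].
  - move=> z; rewrite -[X in _ --> X]mul1r; apply: cvgM; last exact: cvg_cst.
    apply: cvg_near_cst; near=> n.
    rewrite indicE mem_set//= /D /= in_itv/= -ler_norml.
    near: n; exists (Num.bound z) => //= n /= zn.
    apply: (le_trans (ltW (archi_boundP (normr_ge0 z)))).
    rewrite /Num.bound normr_id -/(Num.bound z) ler_nat.
    exact: leq_trans zn (leqnSn _).
  - move=> n z; apply: le_trans (dK z); rewrite normrM ler_piMl//.
    by rewrite indicE; case: (_ \in _); rewrite ?normr1 ?normr0.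
have l0 : H n.+1%:R - H (- n.+1%:R) @[n --> \oo] --> (0 : R).
  apply: norm_cvg0.
  have K0 : 2 * K * (expR (c%:R * n.+1%:R) * gam n.+1%:R) @[n --> \oo] --> (0 : R).
    by rewrite -[X in _ --> X](mulr0 (2 * K)); apply: cvgM; [exact: cvg_cst|exact: expgam_cvg0].
  apply: (squeeze_cvgr _ _ K0); last exact: cvg_cst.
  near=> n; rewrite /= normr_ge0/=.
  apply: (le_trans (ler_normB _ _)); rewrite /H !normrM !(ger0_norm (gam_ge0 _)).
  have gN : gam (- n.+1%:R) = gam n.+1%:R by rewrite !gamE sqrrN.
  rewrite gN -mulrDl mulrA ler_wpM2r ?gam_ge0//.
  rewrite -[2]/(1 + 1) mulrDl mul1r mulrDl lerD//.
    by apply: le_trans (hK _) _; rewrite ger0_norm.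
  by apply: le_trans (hK _) _; rewrite normrN ger0_norm.
move: l1; under eq_fun do rewrite I1.
by move=> l1; exact: (cvg_unique _ l1 l0).
Unshelve. all: by end_near. Qed.

Lemma gE_stein f g v : tame f -> tame g -> is_pderive 0 f g ->
  gE (fun w => w 0%N * f w) v = gE g v.
Proof.
move=> tf tg dfg.
pose k w := g w - w 0%N * f w.
have tp : tame (fun w : nat -> R => w 0%N * f w).
  by apply: tameM => //; exact: tame_proj.
have tk : tame k by exact: tameB.
have [_ [a fa]] := tf; have [_ [b kb]] := tk.
have upd0 (y : R) : upd (scons 0 v) 0 y = scons y v.
  by apply/funext => -[].
suff : gE k v = 0.
  rewrite /k gED//; last exact: tameN.
  have -> : gE (fun w => - (w 0%N * f w)) v = - gE (fun w => w 0%N * f w) v.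
    rewrite -mulN1r -(gEZ (fun=> -1))//; congr gE.
    by apply/funext => w; rewrite mulN1r.
  by move/eqP; rewrite subr_eq0 => /eqP.
apply: (@integral_derive_gam (fun z => f (scons z v)) (fun z => g (scons z v))
  (growth (a + b) v) (a + b)).
- move=> x; have := dfg (scons 0 v) x; under eq_fun do rewrite upd0.
  by rewrite upd0.
- exact: tame_slice_continuous.
- by apply: tame_slice_bound => w; exact: le_trans (fa w) (growthDl _ _ _).
- move=> z; have /= := tame_slice_bound k (a + b) v _ z; apply.
  by move=> w; exact: le_trans (kb w) (growthDr _ _ _).
Qed.

End Stein.

(** * Expectation over several coordinates *)

Section IteratedExpectation.
Context {R : realType}.
Notation mu := (@lebesgue_measure R).
Notation gam := (normal_pdf (0 : R) 1).
Implicit Types (f g : (nat -> R) -> R) (u v : nat -> R) (c d k : nat).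

Lemma tame_iter d f : tame f -> tame (iter d gE f).
Proof. by move=> tf; elim: d => // d; exact: tame_gE. Qed.

Lemma iter_gED d f g : tame f -> tame g ->
  iter d gE (fun v => f v + g v) = (fun v => iter d gE f v + iter d gE g v).
Proof.
move=> tf tg; elim: d => //= d ->; apply/funext => v.
by rewrite gED//; exact: tame_iter.
Qed.

Lemma iter_gEZ d (h : (nat -> R) -> R) f : tame f ->
  iter d gE (fun v => h (fun i => v (d + i)%N) * f v) =
  (fun v => h v * iter d gE f v).
Proof.
elim: d f => // d IH f tf; rewrite !iterSr -IH; last exact: tame_gE.
by congr (iter d gE _); apply/funext => v; exact: (gEZ (fun w => h (fun i => w (d + i)%N))).
Qed.

Lemma iter_gE_shift d (h : (nat -> R) -> R) :
  iter d gE (fun v => h (fun i => v (d + i)%N)) = h.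
Proof.
elim: d => // d IH; rewrite iterSr -[RHS]IH; congr (iter d gE _).
by apply/funext => v; exact: (gE_shift (fun w => h (fun i => w (d + i)%N))).
Qed.

Lemma iter_gE_cst d (x : R) f v : (forall v, f v = x) -> iter d gE f v = x.
Proof.
move=> fx; have -> : f = fun=> x by exact/funext.
by rewrite (iter_gE_shift d (fun=> x)).
Qed.

Lemma iter_gEZc d (x : R) f : tame f ->
  iter d gE (fun v => x * f v) = (fun v => x * iter d gE f v).
Proof. by move=> tf; rewrite -(iter_gEZ d (fun=> x)). Qed.

Lemma iter_gEN d f : tame f ->
  iter d gE (fun v => - f v) = (fun v => - iter d gE f v).
Proof.
move=> tf; under eq_fun do rewrite -mulN1r.
by rewrite iter_gEZc//; apply/funext => v; rewrite mulN1r.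
Qed.

Lemma iter_gEB d f g : tame f -> tame g ->
  iter d gE (fun v => f v - g v) = (fun v => iter d gE f v - iter d gE g v).
Proof.
by move=> tf tg; rewrite iter_gED; [rewrite iter_gEN|exact: tf|exact: tameN].
Qed.

Lemma iter_gE_sum d (I : Type) (r : seq I) (P : pred I) (F : I -> (nat -> R) -> R) :
  (forall i, P i -> tame (F i)) ->
  iter d gE (fun v => \sum_(i <- r | P i) F i v) =
  (fun v => \sum_(i <- r | P i) iter d gE (F i) v).
Proof.
move=> tF; elim: r => [|i r IH].
  under eq_fun do rewrite big_nil.
  by rewrite (iter_gE_shift d (fun=> 0)); apply/funext => v; rewrite big_nil.
have [Pi|Pi] := boolP (P i).
  under eq_fun do rewrite big_cons Pi.
  rewrite iter_gED; [|exact: tF|exact: tame_sum].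
  by rewrite IH; apply/funext => v; rewrite big_cons Pi.
under eq_fun do rewrite big_cons (negbTE Pi).
by rewrite IH; apply/funext => v; rewrite big_cons (negbTE Pi).
Qed.

Lemma iter_gE_le d f g v : tame f -> tame g -> (forall v, f v <= g v) ->
  iter d gE f v <= iter d gE g v.
Proof.
move=> tf tg fg; elim: d v => [|d IH] v; first exact: fg.
by apply: gE_le => //; exact: tame_iter.
Qed.

Lemma is_pderive_iter d k f g : tame f -> tame g ->
  is_pderive (d + k)%N f g -> is_pderive k (iter d gE f) (iter d gE g).
Proof.
elim: d f g => // d IH f g tf tg dfg; rewrite !iterSr; apply: IH.
- exact: tame_gE.
- exact: tame_gE.
- exact: is_pderive_gE.
Qed.

(** The k innermost averages commute with multiplication by w k and with differentiation in it;
    after them coordinate k has become coordinate 0, where Stein's identity applies. *)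
Lemma iter_gE_stein d k f g : (k < d)%N -> tame f -> tame g ->
  is_pderive k f g ->
  iter d gE (fun w => w k * f w) = iter d gE g.
Proof.
move=> kd tf tg dfg; rewrite -(subnK kd) !iterD /=; congr iter.
apply/funext => v.
have -> : iter k gE (fun w => w k * f w) = (fun w => w 0%N * iter k gE f w).
  rewrite -(iter_gEZ k (fun w => w 0%N))//; congr iter.
  by apply/funext => w; rewrite /= addn0.
apply: gE_stein; [exact: tame_iter..|].
by have := is_pderive_iter k 0 f g tf tg; rewrite addn0; apply.
Qed.

(** A common growth bound passes to the averages, so dominated convergence can be repeated one
    coordinate at a time. *)
Lemma iter_gE_cvg d c (F : nat -> (nat -> R) -> R) (G : (nat -> R) -> R) v :
  (forall n, tame (F n)) -> (forall n v, `|F n v| <= growth c v) ->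
  (forall v, F n v @[n --> \oo] --> G v) ->
  iter d gE (F n) v @[n --> \oo] --> iter d gE G v.
Proof.
elim: d c F G v => [|d IH] c F G v tF Fc FG; first exact: FG.
rewrite iterSr; under eq_fun do rewrite iterSr.
have [c' h] := @gE_growth R c.
apply: (IH c') => [n|n w|w]; first exact: tame_gE.
  exact: h.
apply: (@gaussian_dct _ _ _ (growth c w) c).
- by move=> n; exact: measurable_tame_slice.
- by move=> z; exact: FG.
- by move=> n; exact: tame_slice_bound.
Qed.

Lemma gam_gt0 z : 0 < gam z.
Proof.
by rewrite gamE mulr_gt0 ?expR_gt0// normal_peak_gt0// oner_eq0.
Qed.

Lemma gE_gt0 f v : tame f -> (forall v, 0 < f v) -> 0 < gE f v.
Proof.
move=> tf f0; rewrite lt0r; apply/andP; split; last first.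
  by apply: Rintegral_ge0 => z _; rewrite mulr_ge0 ?gam_ge0// ltW.
apply/negP => /eqP E0.
have iF := gE_integrable f v tf.
have mF : measurable_fun setT (fun z => (f (scons z v) * gam z)%:E).
  exact: (measurable_int mu).
have E1 : (\int[mu]_z `|(f (scons z v) * gam z)%:E| = 0)%E.
  transitivity (\int[mu]_z (f (scons z v) * gam z)%:E)%E.
    by apply: eq_integral => z _; rewrite gee0_abs// lee_fin mulr_ge0 ?gam_ge0// ltW.
  by rewrite -[LHS]fineK; [rewrite [X in X%:E]E0|exact: integrable_fin_num].
have /(ae_eq_integral_abs mu measurableT mF)[A [mA A0 sA]] := E1.
(* A zero integral would make the positive integrand vanish almost everywhere: the exceptional null
   set would be the whole line. *)
have AT : A = setT.
  apply/seteqP; split => // z _; apply: sA => /= /(_ I)/eqP.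
  by rewrite eqe gt_eqF// mulr_gt0 ?gam_gt0.
have : (mu [set` (Interval -oo%O +oo%O : interval R)] = 0)%E by rewrite set_itvNyy -AT.
by rewrite lebesgue_measure_itv.
Qed.

Lemma iter_gE_gt0 d f v : tame f -> (forall v, 0 < f v) -> 0 < iter d gE f v.
Proof.
move=> tf f0; elim: d v => [|d IH] v; first exact: f0.
by apply: gE_gt0 => //; exact: tame_iter.
Qed.

End IteratedExpectation.

(** * Derivative of the conditional entropy *)

Section LogSumExp.
Context {R : realType} {I : finType} (P : pred I).
Implicit Types (q dq : I -> (nat -> R) -> R) (v : nat -> R).

Definition sumexp q v : R := \sum_(j | P j) expR (q j v).
Definition lse q v : R := ln (sumexp q v).
(** With q j the log-likelihood ratio of j, this is the posterior probability of j within P, and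
    [softmean] is the posterior mean. *)
Definition softmax q j v : R := expR (q j v) / sumexp q v.
Definition softmean q (y : I -> R) v : R := \sum_(j | P j) softmax q j v * y j.

Lemma sumexp_ge q j v : P j -> expR (q j v) <= sumexp q v.
Proof.
by move=> Pj; rewrite /sumexp (bigD1 j)//= lerDl sumr_ge0// => *; exact: expR_ge0.
Qed.

Variables (i0 : I) (Pi0 : P i0).

Lemma sumexp_gt0 q v : 0 < sumexp q v.
Proof. by apply: lt_le_trans (sumexp_ge q i0 v Pi0); exact: expR_gt0. Qed.

Lemma softmax_gt0 q j v : 0 < softmax q j v.
Proof. by rewrite divr_gt0 ?expR_gt0 ?sumexp_gt0. Qed.

Lemma softmax_le1 q j v : P j -> softmax q j v <= 1.
Proof. by move=> Pj; rewrite ler_pdivrMr ?sumexp_gt0// mul1r sumexp_ge. Qed.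

(** Continuity only: the exponents used below are quadratic, so this sum may outgrow every
    [growth c]. Its logarithm and its normalized terms are tame again. *)
Lemma seqcont_sumexp q : (forall j, tame (q j)) -> seqcont (sumexp q).
Proof.
move=> tq u v uv; apply: cvg_bigsum => j _.
apply: continuous_seq; first exact: continuous_expR.
by have [cq _] := tq j; exact: cq.
Qed.

Lemma tame_softmax q j : P j -> (forall j, tame (q j)) -> tame (softmax q j).
Proof.
move=> Pj tq; apply: (tame_le _ (fun=> 1)); last 2 first.
- exact: tame_cst.
- by move=> v; rewrite normr1 ger0_norm ?softmax_le1// ltW// softmax_gt0.
move=> u v uv; apply: cvgM.
  apply: continuous_seq; first exact: continuous_expR.
  by have [cq _] := tq j; exact: cq.
apply: cvgV; first by rewrite gt_eqF// sumexp_gt0.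
exact: seqcont_sumexp.
Qed.

Lemma lse_bound q v : `|lse q v| <= #|I|%:R + \sum_j `|q j v|.
Proof.
set S := \sum_j `|q j v|.
have qS j : `|q j v| <= S by rewrite /S (bigD1 j)//= lerDl sumr_ge0.
rewrite ler_norml; apply/andP; split.
  apply: (@le_trans _ _ (q i0 v)).
    have := qS i0; have := ler_norm (- q i0 v); rewrite normrN.
    by have : 0 <= #|I|%:R :> R by []; lra.
  by rewrite -[leLHS]expRK ler_ln ?posrE ?expR_gt0 ?sumexp_gt0// sumexp_ge.
have I0 : (0 < #|I|)%N by apply/card_gt0P; exists i0.
have h : sumexp q v <= #|I|%:R * expR S.
  rewrite /sumexp -sum1_card natr_sum mulr_suml [leRHS](bigID P)/=.
  rewrite -[leLHS]addr0 lerD//; last by rewrite sumr_ge0// => *; rewrite mul1r expR_ge0.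
  apply: ler_sum => j _; rewrite mul1r ler_expR.
  exact: le_trans (ler_norm _) (qS j).
apply: (@le_trans _ _ (ln (#|I|%:R * expR S))).
  by rewrite ler_ln ?posrE ?sumexp_gt0// mulr_gt0 ?ltr0n ?expR_gt0.
rewrite lnM ?posrE ?ltr0n ?expR_gt0// expRK lerD2r.
by apply: le_trans (ltW (ln_sublinear _)) _; rewrite ?ltr0n.
Qed.

Lemma tame_lse q : (forall j, tame (q j)) -> tame (lse q).
Proof.
move=> tq; apply: (tame_le _ (fun v => #|I|%:R + \sum_j `|q j v|)).
- move=> u v uv; apply: continuous_seq; last exact: seqcont_sumexp.
  exact/continuous_ln/sumexp_gt0.
- apply: tameD; first exact: tame_cst.
  by apply: tame_sum => j _; apply: tame_norm.
- move=> v; apply: le_trans (lse_bound q v) _; exact: ler_norm.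
Qed.

Lemma tame_softmean q y : (forall j, tame (q j)) -> tame (softmean q y).
Proof.
move=> tq; apply: tame_sum => j Pj; apply: tameM; first exact: tame_softmax.
exact: tame_cst.
Qed.

Variables (q dq : I -> (nat -> R) -> R) (k : nat).
Hypothesis qdq : forall j, is_pderive k (q j) (dq j).

Lemma is_pderive_sumexp :
  is_pderive k (sumexp q) (fun v => \sum_(j | P j) expR (q j v) * dq j v).
Proof.
move=> v x; apply: is_derive_sumf => j _.
exact: (is_derive_compf _ _ _ _ _ (qdq j v x) (is_derive_expR _)).
Qed.

Lemma is_pderive_lse :
  is_pderive k (lse q) (fun v => \sum_(j | P j) softmax q j v * dq j v).
Proof.
move=> v x; have := is_pderive_sumexp v x.
move=> /is_derive_compf/(_ (is_derive1_ln (sumexp_gt0 q (upd v k x))))[h1 h2].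
apply: DeriveDef => //; rewrite h2 mulr_sumr; apply: eq_bigr => j _.
by rewrite /softmax [in RHS]mulrAC mulrC.
Qed.

Lemma is_pderive_softmax j :
  is_pderive k (softmax q j) (fun v => softmax q j v *
     (dq j v - \sum_(l | P l) softmax q l v * dq l v)).
Proof.
have E v : softmax q j v = expR (q j v + - lse q v).
  by rewrite expRB /lse lnK ?posrE ?sumexp_gt0.
move=> v x; under eq_fun do rewrite E; rewrite E.
apply: (is_derive_compf _ _ _ _ _ _ (is_derive_expR _)).
apply: is_derive_addf; first exact: qdq.
by have := is_pderive_lse v x => h; exact: is_deriveN.
Qed.

(** The derivative is the posterior covariance of dq and y. *)
Lemma is_pderive_softmean y :
  is_pderive k (softmean q y) (fun v => \sum_(j | P j) (softmax q j v *
     (dq j v - \sum_(l | P l) softmax q l v * dq l v)) * y j).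
Proof.
move=> v x; apply: is_derive_sumf => j _.
have h := is_derive_mulf _ _ _ _ _ (is_pderive_softmax j v x)
  (is_derive_cst (y j) x (1 : R)).
by apply: (is_derive_eq h); rewrite mulr0 addr0.
Qed.

End LogSumExp.

Section ChannelEntropy.
Context {R : realType} {I : finType} (x : I -> nat -> R) (d : nat).
Implicit Types (a z v kap lam : nat -> R) (i j : I) (P : pred I).

(* With y = x_i + z / a, this is the logarithm of the likelihood ratio
   p(y | x_j) / p(y | x_i); a_k is the inverse noise deviation in direction k. *)
Definition llr a i j z : R :=
  - \sum_(k < d) (a k * z k * (x i k - x j k) + (a k * (x i k - x j k)) ^+ 2 / 2).

(** The inverse deviations move on the line kap + t lam, with t read from coordinate d, the first
    one that [iter d gE] leaves alone. *)
Definition amp kap lam v k : R := kap k + lam k * v d.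

Definition llra kap lam i j v : R := llr (amp kap lam v) i j v.

Lemma tame_amp kap lam k : tame (fun v => amp kap lam v k).
Proof.
apply: tameD; first exact: tame_cst.
by apply: tameM; [exact: tame_cst|exact: tame_proj].
Qed.

Lemma tame_llra kap lam i j : tame (llra kap lam i j).
Proof.
apply: tameN; apply: tame_sum => k _; apply: tameD.
  apply: tameM; last exact: tame_cst.
  by apply: tameM; [exact: tame_amp|exact: tame_proj].
apply: tameM; last exact: tame_cst.
by apply: tameX; apply: tameM; [exact: tame_amp|exact: tame_cst].
Qed.

Lemma is_pderive_llra_amp kap lam i j :
  is_pderive d (llra kap lam i j) (fun v => - \sum_(k < d)
    (lam k * v k * (x i k - x j k) + lam k * amp kap lam v k * (x i k - x j k) ^+ 2)).
Proof.
move=> v y; apply: is_deriveN; apply: is_derive_sumf => k _.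
have uk (t : R) : upd v d t k = v k by rewrite /upd ltn_eqF.
have ua (t : R) : amp kap lam (upd v d t) k = kap k + lam k * t.
  by rewrite /amp updE.
under eq_fun do rewrite uk ua; rewrite uk ua.
set D := x i k - x j k.
have da : is_derive y (1 : R) (fun t => kap k + lam k * t) (lam k).
  apply: (is_derive_eq (is_derive_addf _ _ _ _ _ (is_derive_cst (kap k) y (1 : R))
    (is_derive_mulf _ _ _ _ _ (is_derive_cst (lam k) y (1 : R)) (is_derive_id y (1 : R))))).
  by rewrite /=; ring.
have dc (c : R) := is_derive_cst c y (1 : R).
have daD := is_derive_mulf _ _ _ _ _ da (dc D).
apply: (is_derive_eq (is_derive_addf _ _ _ _ _
  (is_derive_mulf _ _ _ _ _ (is_derive_mulf _ _ _ _ _ da (dc (v k))) (dc D))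
  (is_derive_mulf _ _ _ _ _ (is_derive_mulf _ _ _ _ _ daD daD) (dc 2^-1)))).
by rewrite /=; field.
Qed.

Lemma is_pderive_llra kap lam i j k : (k < d)%N ->
  is_pderive k (llra kap lam i j) (fun v => - (amp kap lam v k * (x i k - x j k))).
Proof.
move=> kd v y.
have ua (t : R) : amp kap lam (upd v k t) = amp kap lam v.
  by apply/funext => l; rewrite /amp /upd gtn_eqF.
rewrite /llra; under eq_fun do rewrite ua; rewrite ua.
set a := amp kap lam v.
pose dF (l : 'I_d) : R := if l == Ordinal kd then a k * (x i k - x j k) else 0.
have -> : a k * (x i k - x j k) = \sum_(l < d) dF l.
  by rewrite (bigD1 (Ordinal kd))//= /dF eqxx big1 ?addr0// => l /negbTE ->.
apply: is_deriveN; apply: is_derive_sumf => l _; rewrite /dF.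
have dc (c : R) := is_derive_cst c y (1 : R).
case: eqP => [->|lk].
  rewrite /=; under eq_fun do rewrite updE.
  apply: (is_derive_eq (is_derive_addf _ _ _ _ _ (is_derive_mulf _ _ _ _ _
    (is_derive_mulf _ _ _ _ _ (dc (a k)) (is_derive_id y (1 : R)))
    (dc (x i k - x j k))) (dc ((a k * (x i k - x j k)) ^+ 2 / 2)))).
  by rewrite /=; ring.
have ul (t : R) : upd v k t l = v l.
  by rewrite /upd ifF//; apply/eqP => E; apply: lk; exact: val_inj.
under eq_fun do rewrite ul.
exact: dc.
Qed.

(** The error, in direction k, of the posterior mean over P when x i is sent. *)
Definition bias kap lam i P k v : R :=
  softmean P (llra kap lam i) (fun j => x i k - x j k) v.

Lemma tame_bias kap lam i P k : P i -> tame (bias kap lam i P k).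
Proof.
by move=> Pi; apply: (tame_softmean _ i Pi) => j; exact: tame_llra.
Qed.

(* Gaussian integration by parts turns the term z_k of the derivative of the
   log-likelihood ratio into the conditional mean squared error. *)
Lemma is_pderive_iter_lse kap lam i P : P i ->
  is_pderive 0 (iter d gE (lse P (llra kap lam i)))
    (iter d gE (fun v => - \sum_(k < d)
       lam k * amp kap lam v k * bias kap lam i P k v ^+ 2)).
Proof.
move=> Pi.
set q := llra kap lam i.
have tq j : tame (q j) by exact: tame_llra.
pose D k j : R := x i k - x j k.
pose m2 k v := softmean P q (fun j => D k j ^+ 2) v.
pose m1 k v := bias kap lam i P k v.
have tm1 k : tame (m1 k) by exact: tame_bias.
have tm2 k : tame (m2 k) by exact: (tame_softmean _ i Pi).
have tl k : tame (fun v => amp kap lam v k) by exact: tame_amp.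
pose t1 (k : 'I_d) v := lam k * (v k * m1 k v).
pose t2 (k : 'I_d) v := lam k * (amp kap lam v k * m2 k v).
pose t3 (k : 'I_d) v := lam k * (amp kap lam v k * (m1 k v ^+ 2 - m2 k v)).
have tt1 k : tame (t1 k).
  by apply: tameM; [exact: tame_cst|apply: tameM => //; exact: tame_proj].
have tt2 k : tame (t2 k).
  by apply: tameM; [exact: tame_cst|apply: tameM].
have tt3 k : tame (t3 k).
  apply: tameM; [exact: tame_cst|apply: tameM => //].
  by apply: tameB => //; exact: tameX.
(* The derivative of [m1] in z_k is the posterior covariance of -a_k D and D, that is a_k (m1^2 -
   m2). Added to [t2], the second moments cancel and the squared bias remains, for each i
   separately. *)
have E13 k : iter d gE (t1 k) = iter d gE (t3 k).
  rewrite /t1 /t3 !iter_gEZc; last first.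
  - by apply: tameM => //; exact: tame_proj.
  - by apply: tameM => //; apply: tameB => //; exact: tameX.
  apply/funext => v; congr (_ * _).
  have kd := ltn_ord k.
  have dq j := is_pderive_llra kap lam i j k kd.
  have := is_pderive_softmean P i Pi q _ k dq (D k).
  set dm := (X in is_pderive _ _ X).
  have -> : dm = fun v => amp kap lam v k * (m1 k v ^+ 2 - m2 k v).
    apply/funext => w; rewrite /dm /m1 /m2 /bias /softmean -/q.
    set s1 := \sum_(j | P j) softmax P q j w * (x i k - x j k).
    have -> : \sum_(l | P l) softmax P q l w * - (amp kap lam w k * (x i k - x l k))
      = - (amp kap lam w k * s1).
      rewrite /s1 mulr_sumr -sumrN; apply: eq_bigr => l _; ring.
    set s2 := \sum_(j | P j) softmax P q j w * D k j ^+ 2.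
    transitivity (\sum_(j | P j) (amp kap lam w k * s1 * (softmax P q j w * (x i k - x j k))
       - amp kap lam w k * (softmax P q j w * D k j ^+ 2))).
      by apply: eq_bigr => j _; rewrite /D; ring.
    by rewrite big_split/= sumrN -!mulr_sumr -/s1 -/s2; ring.
  move=> /iter_gE_stein -/(_ d kd) H; congr (_ v); apply: H.
    exact: tm1.
  by apply: tameM => //; apply: tameB => //; exact: tameX.
pose dl v := \sum_(j | P j) softmax P q j v * - \sum_(k < d)
    (lam k * v k * (x i k - x j k) + lam k * amp kap lam v k * (x i k - x j k) ^+ 2).
have Edl : dl = fun v => - (\sum_k t1 k v + \sum_k t2 k v).
  apply/funext => v; rewrite /dl -big_split/= -sumrN.
  under eq_bigr do rewrite mulrN mulr_sumr -sumrN.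
  rewrite exchange_big/=; apply: eq_bigr => k _.
  rewrite /t1 /t2 /m1 /m2 /bias /softmean -/q sumrN; congr (- _).
  rewrite !mulr_sumr -big_split/=; apply: eq_bigr => j _.
  by rewrite /D; ring.
have tdl : tame dl.
  by rewrite Edl; apply: tameN; apply: tameD; apply: tame_sum.
have -> : iter d gE (fun v => - \sum_(k < d)
    lam k * amp kap lam v k * bias kap lam i P k v ^+ 2) = iter d gE dl.
  rewrite Edl [RHS]iter_gEN; last by apply: tameD; apply: tame_sum.
  rewrite iter_gED; [|exact: tame_sum..].
  rewrite !iter_gE_sum//.
  under [RHS]eq_fun do under eq_bigr do rewrite E13.
  rewrite iter_gEN; last first.
    apply: tame_sum => k _; apply: tameM; last exact: tameX.
    by apply: tameM => //; exact: tame_cst.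
  rewrite iter_gE_sum; last first.
    move=> k _; apply: tameM; last exact: tameX.
    by apply: tameM => //; exact: tame_cst.
  apply/funext => v; congr (- _); rewrite -big_split/=; apply: eq_bigr => k _.
  have <- : iter d gE (fun v => t3 k v + t2 k v) v = iter d gE (t3 k) v + iter d gE (t2 k) v.
    by rewrite iter_gED.
  congr (iter d gE _ v); apply/funext => w; rewrite /t3 /t2 /m1; ring.
apply: is_pderive_iter => //; first exact: (tame_lse _ i Pi).
rewrite addn0; apply: (is_pderive_lse P i Pi q _ d) => j.
exact: is_pderive_llra_amp.
Qed.

End ChannelEntropy.

(** * From the channel output to normalized noise *)

Section AffineSubstitution.
Context {R : realType}.
Notation mu := (@lebesgue_measure R).
Notation gam := (normal_pdf (0 : R) 1).

Lemma ge0_integral_affine (G : R -> R) (s x : R) : 0 < s -> continuous G ->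
  (forall z, 0 <= G z) ->
  (\int[mu]_b (G ((b - x) / s) * s^-1)%:E)%E = (\int[mu]_z (G z)%:E)%E.
Proof.
move=> s0 cG G0; pose F (b : R) : R := (b - x) / s.
have dF (b : R) : is_derive b (1 : R) F s^-1.
  have h := is_derive_mulf _ _ _ _ _ (is_derive_addf _ _ _ _ _
    (is_derive_id b (1 : R)) (is_derive_cst (- x) b (1 : R)))
    (is_derive_cst s^-1 b (1 : R)).
  by apply: (is_derive_eq h); rewrite mulr0 !addr0 mul1r.
have F'E : F^`() = cst s^-1.
  by apply/funext => b; rewrite derive1E; exact: derive_val.
have si : 0 < s^-1 by rewrite invr_gt0.
rewrite (@increasing_ge0_integration_by_substitutionT _ F G) //.
- by apply: eq_integral => b _; rewrite F'E.
- by move=> a b ab; rewrite /F ltr_pM2r// ltrD2r.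
- by rewrite F'E => ?; exact: cvg_cst.
- by rewrite F'E; exact: is_cvg_cst.
- by rewrite F'E; exact: is_cvg_cst.
- by apply/gt0_cvgMlNy => //; exact: cvg_addrr_Ny.
- by apply/gt0_cvgMly => //; exact: cvg_addrr.
Qed.

Lemma integral_affine (G : R -> R) (s x : R) : 0 < s -> continuous G ->
  (\int[mu]_b (G ((b - x) / s) * s^-1)%:E)%E = (\int[mu]_z (G z)%:E)%E.
Proof.
move=> s0 cG; have si : 0 <= s^-1 by rewrite invr_ge0 ltW.
have cmax (H : R -> R) : continuous H -> continuous (fun z => Num.max (H z) 0).
  move=> cH z; under eq_fun do rewrite maxr_absE.
  apply: cvgM; last exact: cvg_cst.
  apply: cvgD; first by apply: cvgD; [exact: cH|exact: cvg_cst].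
  by apply: cvg_norm; apply: cvgB; [exact: cH|exact: cvg_cst].
rewrite [LHS]integralE [RHS]integralE; congr (_ - _)%E.
- transitivity (\int[mu]_b ((Num.max (G ((b - x) / s)) 0) * s^-1)%:E)%E.
    apply: eq_integral => b _.
    by rewrite funeposE -EFin_max maxr_pMl// mul0r.
  rewrite (ge0_integral_affine (fun z => Num.max (G z) 0))//; last first.
  - by move=> z; rewrite le_max lexx orbT.
  - exact: cmax.
  by apply: eq_integral => z _; rewrite funeposE -EFin_max.
- transitivity (\int[mu]_b ((Num.max (- G ((b - x) / s)) 0) * s^-1)%:E)%E.
    apply: eq_integral => b _.
    by rewrite funenegE -EFinN -EFin_max maxr_pMl// mul0r mulNr.
  rewrite (ge0_integral_affine (fun z => Num.max (- G z) 0))//; last first.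
  - by move=> z; rewrite le_max lexx orbT.
  - by apply: (cmax (fun z => - G z)) => z; apply: cvgN; exact: cG.
  by apply: eq_integral => z _; rewrite funenegE -EFinN -EFin_max.
Qed.

Lemma integrable_affine (G : R -> R) (s x : R) : 0 < s -> continuous G ->
  mu.-integrable setT (EFin \o G) ->
  mu.-integrable setT (EFin \o (fun b => G ((b - x) / s) * s^-1)).
Proof.
move=> s0 cG /integrableP[_ iG]; apply/integrableP; split.
  apply/measurable_EFinP; apply: continuous_measurable_fun => b.
  apply: cvgM; last exact: cvg_cst.
  apply: (cvg_comp (fun b => (b - x) / s) G); last exact: cG.
  by apply: cvgM; [apply: cvgB; [exact: cvg_id|exact: cvg_cst]|exact: cvg_cst].
suff -> : (\int[mu]_b `|(EFin \o (fun b => G ((b - x) / s) * s^-1)%R) b| =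
  \int[mu]_z `|(EFin \o G) z|)%E by [].
rewrite -(integral_affine (fun z => `|G z|) s x s0).
  apply: eq_integral => b _; rewrite /= normrM (ger0_norm (_ : 0 <= s^-1))//.
  by rewrite invr_ge0 ltW.
by move=> z; apply: cvg_norm; exact: cG.
Qed.

Definition gpdf (s u : R) : R := gam (u / s) * s^-1.

Lemma gaussE (s : R) (z : R * R) : 0 < s -> gauss s z = gpdf s z.1 * gpdf s z.2.
Proof.
move=> s0; rewrite /gauss /gpdf !gamE.
have sn : s != 0 by rewrite gt_eqF.
have -> : (2 * pi * s ^+ 2)^-1 = (normal_peak 1 * s^-1) * (normal_peak 1 * s^-1) :> R.
  have h : normal_peak (1 : R) * normal_peak 1 = (2 * pi)^-1.
    rewrite /normal_peak -expr2 exprVn sqr_sqrtr; last first.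
      by rewrite mulrn_wge0// mulr_ge0 ?pi_ge0// expr1n.
    by rewrite expr1n mul1r mulr_natl.
  by rewrite [RHS]mulrACA h -!invfM expr2.
have -> : expR (- (z.1 ^+ 2 + z.2 ^+ 2) / (2 * s ^+ 2)) =
    expR (- ((z.1 / s) ^+ 2 / 2)) * expR (- ((z.2 / s) ^+ 2 / 2)).
  by rewrite -expRD; congr expR; field.
ring.
Qed.

(** The substitution b = x i + s z differs from one summand to the next, so the sum is split first;
    tameness gives the integrability this takes. *)
Lemma integral_mixture (J : finType) (kap x : J -> R) (s : R)
    (Phi : J -> (nat -> R) -> R) (w : J -> nat -> R) :
  0 < s -> (forall i, tame (Phi i)) ->
  (\int[mu]_b (\sum_i kap i * gpdf s (b - x i) *
      Phi i (scons ((b - x i) / s) (w i)))%:E)%E =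
  (\sum_i kap i * gE (Phi i) (w i))%:E.
Proof.
move=> s0 tPhi.
pose G i z := Phi i (scons z (w i)) * gam z.
have cG i : continuous (G i).
  move=> z; apply: cvgM; last exact: continuous_gam.
  exact: tame_slice_continuous.
have iG i : mu.-integrable setT (EFin \o (G i)) by exact: gE_integrable.
have iGs i := integrable_affine (G i) s (x i) s0 (cG i) (iG i).
transitivity (\int[mu]_b \sum_i (kap i)%:E * (G i ((b - x i) / s) * s^-1)%:E)%E.
  apply: eq_integral => b _; rewrite -sumEFin; apply: eq_bigr => i _.
  by rewrite /= -EFinM /G /gpdf; congr EFin; ring.
rewrite integral_sum//; last by move=> i; apply: integrableZl => //; exact: iGs.
rewrite -sumEFin; apply: eq_bigr => i _.
rewrite integralZl//; last exact: iGs.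
rewrite integral_affine// EFinM /gE /Rintegral fineK//.
exact: (integrable_fin_num measurableT (iG i)).
Qed.

End AffineSubstitution.

Section IteratedIntegral.
Context {R : realType} (J : finType).

(** [iintC] integrates symbol 0 outermost, and [cint] the real part outside the imaginary one.
    Pushing coordinates in this order leaves the innermost variable at coordinate 0, as in
    [iter d gE]. *)
Fixpoint zcoords (N : nat) (s : nat -> R) (X y : nat -> R * R) (w : nat -> R) :
    nat -> R :=
  if N is N'.+1 then
    zcoords N' (fun t => s t.+1) (fun t => X t.+1) (fun t => y t.+1)
      (scons (((y 0%N).2 - (X 0%N).2) / s 0%N)
        (scons (((y 0%N).1 - (X 0%N).1) / s 0%N) w))
  else w.

(** The induction peels off symbol 0 and moves its density into the weights, which must therefore be
    arbitrary. *)
Lemma iintC_mixture (N : nat) (s : nat -> R) (X : J -> nat -> R * R)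
    (kap : J -> R) (Phi : J -> (nat -> R) -> R) (w : J -> nat -> R) :
  (forall t, 0 < s t) -> (forall i, tame (Phi i)) ->
  iintC N (fun y => (\sum_i kap i * (\prod_(t < N) gauss (s t) (csub (y t) (X i t))) *
      Phi i (zcoords N s (X i) y (w i)))%:E) =
  (\sum_i kap i * iter N.*2 gE (Phi i) (w i))%:E.
Proof.
move=> s0 tPhi; elim: N s s0 X kap w => [|N IH] s s0 X kap w.
  by rewrite /=; congr EFin; apply: eq_bigr => i _; rewrite big_ord0 mulr1.
rewrite [LHS]/=.
pose Psi i := iter N.*2 gE (Phi i).
have tPsi i : tame (Psi i) by exact: tame_iter.
transitivity (cint (fun z => (\sum_i (kap i * gpdf (s 0%N) (z.1 - (X i 0%N).1) *
    gpdf (s 0%N) (z.2 - (X i 0%N).2)) *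
    Psi i (scons ((z.2 - (X i 0%N).2) / s 0%N)
       (scons ((z.1 - (X i 0%N).1) / s 0%N) (w i))))%:E)).
  congr cint; apply/funext => z.
  rewrite -(IH (fun t => s t.+1) (fun t => s0 t.+1) (fun i t => X i t.+1)
    (fun i => kap i * gpdf (s 0%N) (z.1 - (X i 0%N).1) *
       gpdf (s 0%N) (z.2 - (X i 0%N).2))
    (fun i => scons ((z.2 - (X i 0%N).2) / s 0%N)
       (scons ((z.1 - (X i 0%N).1) / s 0%N) (w i)))).
  congr iintC; apply/funext => y; congr EFin; apply: eq_bigr => i _.
  by rewrite big_ord_recl /= gaussE//= !mulrA.
rewrite /cint.
transitivity (\int[@lebesgue_measure R]_a (\sum_i kap i * gpdf (s 0%N) (a - (X i 0%N).1) *
    gE (Psi i) (scons ((a - (X i 0%N).1) / s 0%N) (w i)))%:E)%E.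
  apply: eq_integral => a _.
  exact: (integral_mixture J (fun i => kap i * gpdf (s 0%N) (a - (X i 0%N).1))
    (fun i => (X i 0%N).2) (s 0%N) Psi
    (fun i => scons ((a - (X i 0%N).1) / s 0%N) (w i))).
rewrite (integral_mixture J kap (fun i => (X i 0%N).1) (s 0%N) (fun i => gE (Psi i)) w) //.
by move=> i; exact: tame_gE.
Qed.

End IteratedIntegral.

(** * Likelihoods in normalized noise coordinates *)

Section Likelihood.
Context {R : realType}.
Implicit Types (s : nat -> R) (y : nat -> R * R) (w : nat -> R) (N k t : nat).

(* zcoords pushes the last symbol innermost: coordinates 2 (N - 1 - t) and
   2 (N - 1 - t) + 1 belong to symbol t. *)
Definition symidx N k : nat := (N - (k./2).+1)%N.
Definition rcoord N y k : R :=
  if odd k then (y (symidx N k)).1 else (y (symidx N k)).2.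
Definition ramp N s k : R := (s (symidx N k))^-1.

Lemma zcoords_tail N s X y w k : zcoords N s X y w (N.*2 + k)%N = w k.
Proof.
elim: N s X y w k => // N IH s X y w k /=.
by rewrite doubleS !addSn -!addnS IH.
Qed.

Lemma zcoordsE N s X y w k : (k < N.*2)%N ->
  zcoords N s X y w k = (rcoord N y k - rcoord N X k) * ramp N s k.
Proof.
elim: N s X y w => // N IH s X y w; rewrite doubleS => kN.
have [kN2|Nk] := ltnP k N.*2.
  rewrite [LHS]IH// /rcoord /ramp.
  have -> : symidx N.+1 k = (symidx N k).+1.
    by rewrite /symidx subSn// ltn_half_double.
  by [].
have /orP[/eqP ->|/eqP ->] : (k == N.*2) || (k == N.*2.+1).
  by move: kN; rewrite ltnS leq_eqVlt ltnS => /orP[->|kN]; rewrite ?orbT// eqn_leq kN Nk.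
- rewrite -[in LHS](addn0 N.*2) /= zcoords_tail /rcoord /ramp odd_double.
  by rewrite /symidx doubleK subnn.
- rewrite -[in LHS](addn1 N.*2) /= zcoords_tail /rcoord /ramp /= odd_double/=.
  by rewrite /symidx /= uphalf_double subnn.
Qed.

Lemma big_ord_double N (F : nat -> R) :
  \sum_(k < N.*2) F k = \sum_(t < N) (F t.*2 + F t.*2.+1).
Proof.
elim: N => [|N IH]; first by rewrite !big_ord0.
by rewrite doubleS !big_ord_recr/= IH addrA.
Qed.

Lemma sum_symidx N (F : nat -> bool -> R) :
  \sum_(k < N.*2) F (symidx N k) (odd k) = \sum_(t < N) (F t false + F t true).
Proof.
rewrite (big_ord_double N (fun k => F (symidx N k) (odd k))).
rewrite (reindex_inj rev_ord_inj)/=; apply: eq_bigr => t _.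
by rewrite /symidx /= odd_double doubleK uphalf_double -subSn// subSS subKn// ltnW.
Qed.

Lemma gauss_csub (s : R) (y xi xj : R * R) : 0 < s ->
  gauss s (csub y xj) = gauss s (csub y xi) *
    expR (- ((s^-1 * ((y.2 - xi.2) * s^-1) * (xi.2 - xj.2) + (s^-1 * (xi.2 - xj.2)) ^+ 2 / 2)
     + (s^-1 * ((y.1 - xi.1) * s^-1) * (xi.1 - xj.1) + (s^-1 * (xi.1 - xj.1)) ^+ 2 / 2))).
Proof.
move=> s0; have sn : s != 0 by rewrite gt_eqF.
rewrite /gauss -[RHS]mulrA -[in RHS]expRD; congr (_ * expR _); rewrite /csub/=.
by field.
Qed.

Lemma prod_gauss_llr (I : finType) (X : I -> nat -> R * R) N s y w i j :
  (forall t, 0 < s t) ->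
  \prod_(t < N) gauss (s t) (csub (y t) (X j t)) =
  \prod_(t < N) gauss (s t) (csub (y t) (X i t)) *
    expR (llr (fun i => rcoord N (X i)) N.*2 (ramp N s) i j (zcoords N s (X i) y w)).
Proof.
move=> s0.
pose p b (z : R * R) := if b then z.1 else z.2.
pose F t b : R := (s t)^-1 * ((p b (y t) - p b (X i t)) * (s t)^-1) *
    (p b (X i t) - p b (X j t)) + ((s t)^-1 * (p b (X i t) - p b (X j t))) ^+ 2 / 2.
have -> : llr (fun i => rcoord N (X i)) N.*2 (ramp N s) i j
    (zcoords N s (X i) y w) = - \sum_(k < N.*2) F (symidx N k) (odd k).
  by rewrite /llr; congr (- _); apply: eq_bigr => k _; rewrite zcoordsE.
rewrite sum_symidx -sumrN expR_sum -big_split/=; apply: eq_bigr => t _.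
exact: gauss_csub.
Qed.

Lemma negxlog2E (u : R) : negxlog2 u = - (u * ln u) / ln 2.
Proof. by rewrite /negxlog2; case: eqP => [->|_]; rewrite ?mul0r ?oppr0 ?mul0r// mulNr. Qed.

(** The chain rule in disguise: the posterior entropy of the class becomes an average over the
    transmitted i of a difference of log-sums, which will yield H(X|Y) minus H(X|class, Y). *)
Lemma mixture_entropy (I B : finType) (Q : pred I) (cls : I -> B) (l : I -> R) :
  (forall i, 0 < l i) ->
  (\sum_(i | Q i) l i) *
    \sum_b negxlog2 ((\sum_(i | Q i && (cls i == b)) l i) / \sum_(i | Q i) l i) =
  \sum_(i | Q i) l i * ((ln (\sum_(j | Q j) l j)
     - ln (\sum_(j | Q j && (cls j == cls i)) l j)) / ln 2).
Proof.
move=> l0; set S := \sum_(i | Q i) l i.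
rewrite (partition_big cls predT)//= mulr_sumr; apply: eq_bigr => b _.
pose Sb := \sum_(i | Q i && (cls i == b)) l i; rewrite -/Sb.
transitivity (\sum_(i | Q i && (cls i == b)) l i * ((ln S - ln Sb) / ln 2)); last first.
  by apply: eq_bigr => i /andP[_ /eqP ->].
rewrite -mulr_suml -/Sb negxlog2E.
have Sb0 : 0 <= Sb by apply: sumr_ge0 => i _; exact: ltW.
(* A class of zero weight contributes 0 to both sides. *)
move: Sb0; rewrite le_eqVlt => /predU1P[<-|Sb0]; first by rewrite !mul0r oppr0 mul0r mulr0.
have S0 : 0 < S.
  apply: lt_le_trans Sb0 _; rewrite /S (bigID (fun i => cls i == b))/= lerDl.
  by apply: sumr_ge0 => i _; exact: ltW.
rewrite ln_div ?posrE//; field.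
by rewrite (gt_eqF S0) (gt_eqF (_ : 0 < ln 2 :> R)) // ln_gt0// ltr1n.
Qed.

End Likelihood.

Section MixtureEntropy.
Context {R : realType} {I : finType} (N : nat) (X : I -> nat -> R * R).

Definition rpoint i : nat -> R := rcoord N (X i).

(** Divided by #|Q| ln 2, this is H(X | Y, class of X) for X uniform on Q, if P i is the class of i
    in Q; the constant class Q gives H(X|Y). *)
Definition Jsum (Q : pred I) (P : I -> pred I) (a : nat -> R) : R :=
  \sum_(i | Q i) iter N.*2 gE (lse (P i) (llr rpoint N.*2 a i)) (fun=> 0).

Lemma tame_llrc a i j : tame (llr rpoint N.*2 a i j).
Proof.
rewrite (_ : llr _ _ _ _ _ = llra rpoint N.*2 a (fun=> 0) i j).
  exact: tame_llra.
apply/funext => v; rewrite /llra; congr llr; apply/funext => k.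
by rewrite /amp mul0r addr0.
Qed.

Lemma iintC_entropy (B : finType) (Q : pred I) (cls : I -> B) (s : nat -> R) (K : R) :
  (forall t, 0 < s t) ->
  let l i (y : nat -> R * R) := \prod_(t < N) gauss (s t) (csub (y t) (X i t)) in
  iintC N (fun y => (K * (\sum_(i | Q i) l i y) *
    \sum_b negxlog2 ((\sum_(i | Q i && (cls i == b)) l i y) / \sum_(i | Q i) l i y))%:E)
  = (K / ln 2 * (Jsum Q (fun=> Q) (ramp N s) -
       Jsum Q (fun i j => Q j && (cls j == cls i)) (ramp N s)))%:E.
Proof.
move=> s0 l.
have l0 i y : 0 < l i y.
  apply: prodr_gt0 => t _; rewrite gaussE// !mulr_gt0// ?gam_gt0 ?invr_gt0//.
pose a := ramp N s.
pose f1 i := lse Q (llr rpoint N.*2 a i).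
pose f2 i := lse (fun j => Q j && (cls j == cls i)) (llr rpoint N.*2 a i).
pose Phi i := if Q i then (fun v => f1 i v - f2 i v) else (fun=> 0).
have tf1 i : Q i -> tame (f1 i).
  by move=> Qi; apply: (tame_lse _ i) => // j; exact: tame_llrc.
have tf2 i : Q i -> tame (f2 i).
  by move=> Qi; apply: (tame_lse _ i); [rewrite Qi eqxx|move=> j; exact: tame_llrc].
have tPhi i : tame (Phi i).
  rewrite /Phi; case: ifPn => [Qi|_]; last exact: tame_cst.
  by apply: tameB; [exact: tf1|exact: tf2].
transitivity (iintC N (fun y => (\sum_i (if Q i then K / ln 2 else 0) *
    (\prod_(t < N) gauss (s t) (csub (y t) (X i t))) *
    Phi i (zcoords N s (X i) y (fun=> 0)))%:E)).
  congr iintC; apply/funext => y; congr EFin.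
  rewrite -mulrA mixture_entropy//.
  rewrite mulr_sumr [LHS]big_mkcond/=; apply: eq_bigr => i _.
  rewrite /Phi; case: ifPn => [Qi|_]; last by rewrite mul0r mul0r.
  set z := zcoords _ _ _ _ _.
  (* The likelihood of i factors out of both log-sums and cancels in their difference, which leaves
     a function of the noise alone. *)
  have lnE (P : pred I) : P i -> ln (\sum_(j | P j) l j y) =
      ln (l i y) + lse P (llr rpoint N.*2 a i) z.
    move=> Pi; rewrite -lnM ?posrE ?l0//; last exact: (sumexp_gt0 _ i).
    congr ln; rewrite /sumexp mulr_sumr; apply: eq_bigr => j _.
    exact: prod_gauss_llr.
  rewrite (lnE Q)// (lnE (fun j => Q j && (cls j == cls i))) ?Qi ?eqxx//.
  by rewrite -/(l i y) /f1 /f2; ring.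
rewrite (iintC_mixture I N s X _ Phi (fun=> fun=> 0))//; congr EFin.
rewrite /Jsum -sumrB mulr_sumr [RHS]big_mkcond/=; apply: eq_bigr => i _.
rewrite /Phi; case: ifPn => [Qi|_]; last by rewrite mul0r.
by rewrite iter_gEB; [|exact: tf1|exact: tf2].
Qed.

End MixtureEntropy.

(** * Conditional entropy as a function of the noise levels *)

Section JsumAnalysis.
Context {R : realType} {I : finType} (N : nat) (X : I -> nat -> R * R).
Implicit Types (a kap lam v w : nat -> R) (i j : I) (k : nat).

(** This trades a parameter read from the tail of the argument for one fixed inside the function. *)
Lemma iter_gE_eq d (f g : (nat -> R) -> R) w w' :
  (forall v v', (forall k, (k < d)%N -> v k = v' k) ->
     (forall k, v (d + k)%N = w k) -> (forall k, v' (d + k)%N = w' k) ->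
     f v = g v') ->
  iter d gE f w = iter d gE g w'.
Proof.
elim: d f g w w' => [|d IH] f g w w' fg; first exact: fg.
rewrite !iterSr; apply: IH => v v' vv' vw v'w'.
apply: eq_Rintegral => z _; congr (_ * _); apply: fg => k.
- by case: k => // k kd; exact: vv'.
- exact: vw.
- exact: v'w'.
Qed.

Notation x := (rpoint N X).
Notation d := N.*2.

Definition mse (P : pred I) a i k v : R :=
  softmean P (llr x d a i) (fun j => x i k - x j k) v ^+ 2.

Definition Emse (P : pred I) a i k : R := iter d gE (mse P a i k) (fun=> 0).

Lemma tame_mse (P : pred I) a i k : P i -> tame (mse P a i k).
Proof.
move=> Pi; apply: tameX; apply: (tame_softmean _ i Pi) => j; exact: tame_llrc.
Qed.

Lemma llr_eq a i j v v' : (forall k, (k < d)%N -> v k = v' k) ->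
  llr x d a i j v = llr x d a i j v'.
Proof.
by move=> vv'; congr (- _); apply: eq_bigr => k _; rewrite vv'.
Qed.

Lemma lse_eq (P : pred I) a i v v' : (forall k, (k < d)%N -> v k = v' k) ->
  lse P (llr x d a i) v = lse P (llr x d a i) v'.
Proof.
move=> vv'; congr ln; apply: eq_bigr => j _; congr expR; exact: llr_eq.
Qed.

Lemma mse_eq (P : pred I) a i k v v' : (forall k, (k < d)%N -> v k = v' k) ->
  mse P a i k v = mse P a i k v'.
Proof.
move=> vv'; congr (_ ^+ 2); apply: eq_bigr => j _; congr (_ / _ * _).
  by congr expR; exact: llr_eq.
by apply: eq_bigr => l _; congr expR; exact: llr_eq.
Qed.

Let pt (t : R) : nat -> R := upd (fun=> 0) 0 t.

Lemma amp_pt kap lam (t : R) v : (forall k, v (d + k)%N = pt t k) ->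
  amp d kap lam v = (fun k => kap k + lam k * t).
Proof.
by move=> vt; apply/funext => k; rewrite /amp -{1}(addn0 d) vt /pt updE.
Qed.

(** With lam an indicator this is a partial derivative; with lam = 1 it is the derivative along the
    diagonal. *)
Lemma is_derive_Jsum (Q : pred I) (P : I -> pred I) kap lam (t : R) :
  (forall i, Q i -> P i i) ->
  is_derive t (1 : R) (fun t => Jsum N X Q P (fun k => kap k + lam k * t))
    (- \sum_(i | Q i) \sum_(k < d) lam k * (kap k + lam k * t) *
       Emse (P i) (fun k => kap k + lam k * t) i k).
Proof.
move=> QP; rewrite -sumrN; apply: is_derive_sumf => i Qi.
have Pi := QP i Qi.
have := is_pderive_iter_lse x d kap lam i (P i) Pi (fun=> 0) t.
have E1 u : iter d gE (lse (P i) (llra x d kap lam i)) (upd (fun=> 0) 0 u) =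
    iter d gE (lse (P i) (llr x d (fun k => kap k + lam k * u) i)) (fun=> 0).
  apply: iter_gE_eq => v v' vv' vu _.
  rewrite -(lse_eq _ _ _ v v' vv'); congr ln; apply: eq_bigr => j _.
  by congr expR; rewrite /llra (amp_pt kap lam u).
under eq_fun do rewrite E1.
set a := fun k => kap k + lam k * t.
suff -> : iter d gE (fun v => - \sum_(k < d)
    lam k * amp d kap lam v k * bias x d kap lam i (P i) k v ^+ 2) (upd (fun=> 0) 0 t)
  = - \sum_(k < d) lam k * a k * Emse (P i) a i k by [].
have tm k : tame (mse (P i) a i k) by exact: tame_mse.
transitivity (iter d gE (fun v => - \sum_(k < d) lam k * a k * mse (P i) a i k v) (fun=> 0)).
  apply: iter_gE_eq => v v' vv' vt _; congr (- _); apply: eq_bigr => k _.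
  rewrite -(mse_eq _ _ _ _ v v' vv') (amp_pt kap lam t)//; congr (_ * _ ^+ 2).
  by rewrite /bias /softmean /softmax /sumexp /llra (amp_pt kap lam t).
have tz k : tame (fun v => lam k * a k * mse (P i) a i k v).
  by apply: tameM => //; exact: tame_cst.
rewrite iter_gEN; last by apply: tame_sum.
rewrite iter_gE_sum//; congr (- _); apply: eq_bigr => k _.
by rewrite iter_gEZc.
Qed.

Variable Q : pred I.

Definition Jdiag (t : R) : R := Jsum N X Q (fun=> Q) (fun=> t).
Definition Mdiag (t : R) : R :=
  \sum_(i | Q i) \sum_(k < d) Emse Q (fun=> t) i k.

(** The I-MMSE relation, in the amplitude t = 1/sigma. *)
Lemma is_derive_Jdiag (t : R) : is_derive t (1 : R) Jdiag (- (t * Mdiag t)).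
Proof.
have := is_derive_Jsum Q (fun=> Q) (fun=> 0) (fun=> 1) t (fun i Qi => Qi).
have E u : (fun k : nat => 0 + 1 * u) = (fun=> u) :> (nat -> R).
  by apply/funext => k; rewrite add0r mul1r.
under eq_fun do rewrite E.
rewrite E /Jdiag.
suff -> : \sum_(i | Q i) \sum_(k < d) 1 * (0 + 1 * t) * Emse Q (fun=> t) i k =
  t * Mdiag t by [].
rewrite mulr_sumr; apply: eq_bigr => i _; rewrite mulr_sumr; apply: eq_bigr => k _.
by rewrite add0r !mul1r.
Qed.

Lemma continuous_Mdiag : continuous Mdiag.
Proof.
have E i k u : Emse Q (fun=> u) i k = iter d gE (fun v =>
    bias x d (fun=> 0) (fun=> 1) i Q k v ^+ 2) (pt u).
  apply/esym; apply: iter_gE_eq => v v' vv' vu _.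
  rewrite -(mse_eq _ _ _ _ v v' vv') /mse /bias /softmean /softmax /sumexp /llra.
  rewrite (amp_pt (fun=> 0) (fun=> 1) u)//.
  by have -> : (fun k : nat => 0 + 1 * u) = (fun=> u) :> (nat -> R)
    by apply/funext => l; rewrite add0r mul1r.
apply: seqcont_continuous => u l ul.
apply: cvg_bigsum => i Qi; apply: cvg_bigsum => k _.
under eq_fun do rewrite E.
rewrite E; have [h _] : tame (iter d gE
    (fun v => bias x d (fun=> 0) (fun=> 1) i Q k v ^+ 2)).
  by apply: tame_iter; apply: tameX; exact: tame_bias.
apply: h => j; rewrite /pt /upd; case: ifP => // _; exact: cvg_cst.
Qed.

Lemma mse_ge0 (P : pred I) a i k v : 0 <= mse P a i k v.
Proof. exact: sqr_ge0. Qed.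

Lemma Emse_ge0 (P : pred I) a i k : P i -> 0 <= Emse P a i k.
Proof.
move=> Pi; rewrite /Emse -[leLHS](iter_gE_cst d 0 (fun=> 0) (fun=> 0))//.
apply: iter_gE_le; [exact: tame_cst|exact: tame_mse|].
by move=> v; exact: mse_ge0.
Qed.

Lemma Mdiag_ge0 t : 0 <= Mdiag t.
Proof.
by apply: sumr_ge0 => i Qi; apply: sumr_ge0 => k _; exact: Emse_ge0.
Qed.

Definition sqdist i j : R := \sum_(k < d) (x i k - x j k) ^+ 2.

Hypothesis sep : forall i j, Q i -> Q j -> i != j -> 0 < sqdist i j.

(** Take x i of maximal norm. Then <x i, x i - x l> >= |x i - x l|^2 / 2 for every l in Q, so the
    posterior mean of x i - x l has positive inner product with x i and cannot vanish, whatever the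
    noise. *)
Lemma Mdiag_gt0 i1 j1 t : Q i1 -> Q j1 -> i1 != j1 -> 0 < Mdiag t.
Proof.
move=> Qi1 Qj1 ij1.
pose n i : R := \sum_(k < d) x i k ^+ 2.
have [i Qi imax] := @arg_maxP _ _ I i1 Q n Qi1.
have [j Qj ij] : exists2 j, Q j & i != j.
  by have [->|?] := eqVneq i i1; [exists j1|exists i1].
have ge0 l : Q l -> \sum_(k < d) x i k * (x i k - x l k) >= 2^-1 * sqdist i l.
  move=> Ql; have := imax l Ql; rewrite /n /sqdist => nl.
  suff -> : \sum_(k < d) x i k * (x i k - x l k) = 2^-1 *
     (\sum_(k < d) x i k ^+ 2 - \sum_(k < d) x l k ^+ 2 + \sum_(k < d) (x i k - x l k) ^+ 2).
    by rewrite ler_wpM2l ?invr_ge0// lerDr subr_ge0.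
  by rewrite -sumrB -big_split/= mulr_sumr; apply: eq_bigr => k _; field.
rewrite /Mdiag (bigD1 i)//=; apply: ltr_pwDl; last first.
  by apply: sumr_ge0 => l /andP[Ql _]; apply: sumr_ge0 => k _; exact: Emse_ge0.
have tm k : tame (mse Q (fun=> t) i k) by exact: tame_mse.
have -> : \sum_(k < d) Emse Q (fun=> t) i k =
    iter d gE (fun v => \sum_(k < d) mse Q (fun=> t) i k v) (fun=> 0).
  by rewrite iter_gE_sum.
apply: iter_gE_gt0 => [|v]; first exact: tame_sum.
pose D k := softmean Q (llr x d (fun=> t) i) (fun j => x i k - x j k) v.
rewrite lt0r sumr_ge0 ?andbT; last by move=> k _; exact: mse_ge0.
apply/negP; rewrite psumr_eq0; last by move=> k _; exact: mse_ge0.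
move=> /allP D0.
have {}D0 (k : 'I_d) : D k = 0.
  by have := D0 k (mem_index_enum k); rewrite /= sqrf_eq0 => /eqP.
have : \sum_(k < d) x i k * D k = 0 by rewrite big1// => k _; rewrite D0 mulr0.
have -> : \sum_(k < d) x i k * D k = \sum_(l | Q l) softmax Q (llr x d (fun=> t) i) l v *
    \sum_(k < d) x i k * (x i k - x l k).
  under eq_bigr do rewrite /D mulr_sumr.
  rewrite exchange_big/=; apply: eq_bigr => l _; rewrite mulr_sumr.
  by apply: eq_bigr => k _; rewrite mulrCA.
apply/eqP; rewrite gt_eqF// (bigD1 j)//=; apply: ltr_pwDl.
  rewrite mulr_gt0 ?(softmax_gt0 _ i)//; apply: lt_le_trans (ge0 j Qj).
  by rewrite mulr_gt0 ?invr_gt0// sep.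
apply: sumr_ge0 => l /andP[Ql _]; rewrite mulr_ge0//.
  by rewrite ltW// (softmax_gt0 _ i).
apply: le_trans (ge0 l Ql); rewrite mulr_ge0 ?invr_ge0// sumr_ge0// => k _.
exact: sqr_ge0.
Qed.

Lemma llrxx a i v : llr x d a i i v = 0.
Proof.
rewrite /llr big1 ?oppr0// => k _.
by rewrite subrr !mulr0 expr0n/= mul0r addr0.
Qed.

Lemma lse_ge0 a i v : Q i -> 0 <= lse Q (llr x d a i) v.
Proof.
move=> Qi; apply: ln_ge0; rewrite -expR0 -(llrxx a i v); exact: sumexp_ge.
Qed.

Lemma tame_lsec (P : pred I) a i : P i -> tame (lse P (llr x d a i)).
Proof. by move=> Pi; apply: (tame_lse _ i Pi) => j; exact: tame_llrc. Qed.

Lemma Jdiag_ge0 t : 0 <= Jdiag t.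
Proof.
apply: sumr_ge0 => i Qi.
rewrite -[leLHS](iter_gE_cst d 0 (fun=> 0) (fun=> 0))//.
apply: iter_gE_le; [exact: tame_cst|exact: tame_lsec|].
by move=> v; exact: lse_ge0.
Qed.

Lemma Jdiag0 : Jdiag 0 = #|Q|%:R * ln #|Q|%:R.
Proof.
have l0 i j v : llr x d (fun=> 0) i j v = 0.
  by rewrite /llr big1 ?oppr0// => k _; rewrite !mul0r expr0n/= mul0r addr0.
rewrite -sum1_card natr_sum mulr_suml; apply: eq_bigr => i Qi.
rewrite mul1r; apply: iter_gE_cst => v; congr ln; apply: eq_bigr => j _.
by rewrite l0 expR0.
Qed.

(** From (v_k + t D_k / 2)^2 >= 0. The first sum dominates uniformly in t; the second term sends the
    likelihood ratio to 0 as t grows. *)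
Lemma llr_le (t : R) i j v : llr x d (fun=> t) i j v <=
  \sum_(k < d) v k ^+ 2 - (t ^+ 2 / 4) * sqdist i j.
Proof.
rewrite /llr /sqdist mulr_sumr -sumrB -sumrN; apply: ler_sum => k _.
by have := sqr_ge0 (v k + t * (x i k - x j k) / 2); lra.
Qed.

Lemma Jdiag_cvg0 : Jdiag n.+1%:R @[n --> \oo] --> (0 : R).
Proof.
rewrite (_ : 0 = \sum_(i | Q i) 0 :> R); last by rewrite big1.
apply: cvg_bigsum => i Qi.
rewrite -[X in _ --> X](iter_gE_cst d 0 (fun=> 0) (fun=> 0))//.
(* This function bounds [lse] for all n at once; its tameness supplies the common growth bound. *)
have tS : tame (fun v => #|I|%:R + \sum_(k < d) v k ^+ 2).
  apply: tameD; first exact: tame_cst.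
  by apply: tame_sum => k _; apply: tameX; exact: tame_proj.
have [_ [c Sc]] := tS.
apply: (@iter_gE_cvg _ _ c).
- by move=> n; exact: tame_lsec.
- move=> n v; rewrite ger0_norm ?lse_ge0//; apply: le_trans (Sc v).
  apply: le_trans (ler_norm _).
  have Q0 : (0 < #|I|)%N by apply/card_gt0P; exists i.
  set S := \sum_(k < d) v k ^+ 2.
  rewrite /lse -[S]expRK.
  apply: (@le_trans _ _ (ln (#|I|%:R * expR S))).
    rewrite ler_ln ?posrE ?(sumexp_gt0 _ i)// ?mulr_gt0 ?ltr0n ?expR_gt0//.
    rewrite /sumexp -sum1_card natr_sum mulr_suml [leRHS](bigID Q)/=.
    rewrite -[leLHS]addr0 lerD//; last by rewrite sumr_ge0// => *; rewrite mul1r expR_ge0.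
    apply: ler_sum => j _; rewrite mul1r ler_expR.
    apply: le_trans (llr_le _ _ _ _) _; rewrite gerBl mulr_ge0//.
    by apply: sumr_ge0 => k _; exact: sqr_ge0.
  rewrite lnM ?posrE ?ltr0n ?expR_gt0// expRK lerD2r.
  by apply: le_trans (ltW (ln_sublinear _)) _; rewrite ?ltr0n.
- move=> v; rewrite -ln1.
  apply: continuous_seq; first exact: continuous_ln.
  (* In the limit only the transmitted word keeps a nonzero likelihood ratio. *)
  rewrite [X in _ --> X](_ : 1 = \sum_(j | Q j) (j == i)%:R :> R); last first.
    by rewrite (bigD1 i)//= eqxx big1 ?addr0// => j /andP[_ /negbTE ->].
  apply: cvg_bigsum => j Qj.
  have [->|ji] := eqVneq j i.
    by under eq_fun do rewrite llrxx expR0; exact: cvg_cst.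
  rewrite mulr0n; have dl : 0 < sqdist i j by apply: sep; rewrite // eq_sym.
  set S := \sum_(k < d) v k ^+ 2.
  (* With D the squared distance, exp(-t^2 D / 4) <= 4 / (D t) for t >= 1, from exp(u) >= 1 + u and
     t^2 >= t. *)
  pose K : R := expR S * (4 / sqdist i j).
  apply: (@squeeze_cvgr _ _ _ _ (cst 0) (fun n => K * n.+1%:R^-1)).
  + near=> n; rewrite /= expR_ge0/=.
    apply: (@le_trans _ _ (expR S * expR (- (n.+1%:R ^+ 2 / 4 * sqdist i j)))).
      by rewrite -expRD ler_expR; exact: llr_le.
    rewrite /K -[X in _ <= X]mulrA ler_wpM2l ?expR_ge0// expRN.
    have n1 : 1 <= n.+1%:R :> R by rewrite ler1n.
    rewrite -[X in _ <= X]invrK lef_pV2 ?posrE ?expR_gt0 ?invr_gt0 ?mulr_gt0 ?invr_gt0//.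
    apply: le_trans (expR_ge1Dx _); rewrite !invfM !invrK.
    have : 0 <= n.+1%:R * (n.+1%:R - 1) * sqdist i j.
      by rewrite !mulr_ge0 ?subr_ge0// ltW.
    by lra.
  + exact: cvg_cst.
  + rewrite -[X in _ --> X](mulr0 K); apply: cvgM; first exact: cvg_cst.
    exact: cvg_harmonic.
Unshelve. all: by end_near. Qed.

End JsumAnalysis.

(** * Area theorem *)

Section AreaUnderInverse.
Context {R : realType}.
Notation mu := (@lebesgue_measure R).
Variables (J chi dJ dchi alpha : R -> R) (c : R).
Hypothesis c0 : 0 < c.
Hypothesis J'E : forall t : R, is_derive t (1 : R) J (dJ t).
Hypothesis chi'E : forall t : R, is_derive t (1 : R) chi (dchi t).
Hypothesis cdJ : continuous dJ.
Hypothesis cdchi : continuous dchi.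
Hypothesis dJ_le0 : forall t, 0 < t -> dJ t <= 0.
Hypothesis dchi_lt0 : forall t, 0 < t -> dchi t < 0.
Hypothesis chi0 : chi 0 = c.
Hypothesis chi_ge0 : forall t, 0 <= chi t.
Hypothesis J_ge0 : forall t, 0 <= J t.
Hypothesis J_cvg0 : J n.+1%:R @[n --> \oo] --> (0 : R).
Hypothesis alphaP : forall h, 0 < h < c -> 0 < alpha h /\ chi (alpha h) = h.

Lemma derive_continuous (f df : R -> R) :
  (forall t : R, is_derive t (1 : R) f (df t)) -> continuous f.
Proof.
by move=> fdf t; apply/differentiable_continuous/derivable1_diffP; exact: ex_derive.
Qed.

Lemma chi_lt a b : 0 <= a -> a < b -> chi b < chi a.
Proof.
move=> a0 ab; rewrite -subr_lt0.
have [|y /[!in_itv]/= /andP[ay _] ->] := @MVT R chi dchi a b ab (fun y _ => chi'E y).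
  by apply: continuous_subspaceT; exact: derive_continuous chi'E.
by rewrite nmulr_rlt0 ?subr_gt0// dchi_lt0// (le_lt_trans a0).
Qed.

Lemma J_le a b : 0 <= a -> a < b -> J b <= J a.
Proof.
move=> a0 ab; rewrite -subr_le0.
have [|y /[!in_itv]/= /andP[ay _] ->] := @MVT R J dJ a b ab (fun y _ => J'E y).
  by apply: continuous_subspaceT; exact: derive_continuous J'E.
by rewrite mulr_le0_ge0 ?dJ_le0 ?(le_lt_trans a0)// subr_ge0 ltW.
Qed.

Lemma chi_gt0 t : 0 <= t -> 0 < chi t.
Proof.
move=> t0; apply: le_lt_trans (chi_ge0 (t + 1)) _.
by apply: chi_lt => //; rewrite ltrDl.
Qed.

Lemma chi_inj a b : 0 < a -> 0 < b -> chi a = chi b -> a = b.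
Proof.
move=> a0 b0 E; have [ab|ba|//] := ltgtP a b.
- by have := chi_lt a b (ltW a0) ab; rewrite E ltxx.
- by have := chi_lt b a (ltW b0) ba; rewrite E ltxx.
Qed.

Lemma alpha_gt h t : 0 < h < c -> 0 <= t -> h < chi t -> t < alpha h.
Proof.
move=> hc t0 ht; have [a0 ah] := alphaP h hc; rewrite ltNge; apply/negP.
rewrite le_eqVlt => /predU1P[E|at_]; first by move: ht; rewrite -E ah ltxx.
by have := lt_trans ht (chi_lt _ _ (ltW a0) at_); rewrite ah ltxx.
Qed.

Lemma alpha_lt h t : 0 < h < c -> 0 <= t -> chi t < h -> alpha h < t.
Proof.
move=> hc t0 th; have [a0 ah] := alphaP h hc; rewrite ltNge; apply/negP.
rewrite le_eqVlt => /predU1P[E|ta]; first by move: th; rewrite E ah ltxx.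
by have := lt_trans (chi_lt _ _ t0 ta) th; rewrite ah ltxx.
Qed.

(** [alpha] is assumed to be a right inverse of [chi] only. Near [alpha h] it is also a left
    inverse, since [chi] is injective on positive reals and takes values in ]0, c[ there; the
    inverse function theorem then applies. *)
Lemma is_derive_alpha h : 0 < h < c ->
  is_derive h (1 : R) alpha (dchi (alpha h))^-1.
Proof.
move=> hc; have [a0 ah] := alphaP h hc.
have cchi := derive_continuous _ _ chi'E.
rewrite -{1}ah; apply: is_derive_inverse.
- have n1 : \forall t \near alpha h, 0 < t by exact: lt_nbhsr.
  have [h0 hc'] := andP hc.
  have n2 : \forall t \near alpha h, 0 < chi t.
    by apply: (cvgr_gt (chi (alpha h)) (cchi _)); rewrite ah.
  have n3 : \forall t \near alpha h, chi t < c.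
    by apply: (cvgr_lt (chi (alpha h)) (cchi _)); rewrite ah.
  near=> t.
  have t0 : 0 < t by near: t.
  have ct : 0 < chi t < c by apply/andP; split; near: t.
  have [at0 E] := alphaP _ ct.
  exact: chi_inj.
- by near=> t; exact: cchi.
- by rewrite lt_eqF// dchi_lt0.
Unshelve. all: by end_near. Qed.

Let g h := dJ (alpha h) / dchi (alpha h).

Lemma continuous_g h : 0 < h < c -> {for h, continuous g}.
Proof.
move=> hc; have [a0 _] := alphaP h hc.
have ca : {for h, continuous alpha}.
  apply/differentiable_continuous/derivable1_diffP.
  by have := is_derive_alpha h hc => -[].
apply: cvgM; first by apply: (cvg_comp _ _ ca); exact: cdJ.
apply: cvgV; first by rewrite lt_eqF// dchi_lt0.
by apply: (cvg_comp _ _ ca); exact: cdchi.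
Qed.

Lemma is_derive_Jalpha h : 0 < h < c -> is_derive h (1 : R) (J \o alpha) (g h).
Proof.
move=> hc.
exact: (is_derive_compf _ _ _ _ _ (is_derive_alpha h hc) (J'E (alpha h))).
Qed.

(** The composite of J with alpha is a primitive on ]0, c[. Towards h = 0 alpha goes to infinity and
    J to 0; towards h = c alpha goes to 0 and J to J 0. *)
Lemma integral_derive_inverse (f : R -> R) :
  (forall h, 0 < h < c -> f h = dJ (alpha h) / dchi (alpha h)) ->
  (\int[mu]_(h in `[0%R, c]) (f h)%:E = (J 0)%:E)%E.
Proof.
move=> fg.
(* Starting the denominators at 3 makes 2 a_i < c. *)
pose a (i : nat) : R := c / i.+3%:R.
have a0 i : 0 < a i by rewrite divr_gt0.
have ac i : a i < c - a i.
  rewrite ltrBrDr -mulr2n -mulr_natr mulrAC -mulrA gtr_pMr// ltr_pdivrMr// mul1r.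
  by rewrite ltr_nat.
have cva : a i @[i --> \oo] --> (0 : R).
  rewrite -[X in _ --> X](mulr0 c); apply: cvgM; first exact: cvg_cst.
  have := @cvg_harmonic R; rewrite -(cvg_shiftn 2).
  by apply: cvg_trans; apply: near_eq_cvg; near=> i; rewrite /harmonic /= addn2.
pose F i : set R := `[a i, c - a i].
have Fin i h : F i h -> 0 < h < c.
  rewrite /F/= in_itv/= => /andP[ah hb].
  by rewrite (lt_le_trans (a0 i) ah)/= (le_lt_trans hb)// gtrBl.
have cF i : {within F i, continuous g}.
  by apply: continuous_in_subspaceT => h /set_mem /Fin; exact: continuous_g.
have FTC i : (\int[mu]_(h in F i) (g h)%:E = (J (alpha (c - a i)) - J (alpha (a i)))%:E)%E.
  have Ja h : 0 < h < c -> {for h, continuous (J \o alpha)}.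
    move=> hc; apply/differentiable_continuous/derivable1_diffP.
    by have := is_derive_Jalpha h hc => -[].
  have Fa : 0 < a i < c by rewrite (Fin i)// /F/= in_itv/= lexx ltW.
  have Fb : 0 < c - a i < c by rewrite (Fin i)// /F/= in_itv/= lexx ltW ?andbT.
  rewrite (@continuous_FTC2 _ g (J \o alpha)) ?EFinB//.
  - exact: cF.
  - split.
    + move=> h /subset_itv_oo_cc hi; have hc := Fin i h hi.
      by have := is_derive_Jalpha h hc => -[].
    + by apply: cvg_at_right_filter; exact: Ja.
    + by apply: cvg_at_left_filter; exact: Ja.
  - move=> h /subset_itv_oo_cc hi; have hc := Fin i h hi.
    by rewrite derive1E; have := is_derive_Jalpha h hc => -[].
have FU : \bigcup_i F i = `]0%R, c[%classic.
  apply/seteqP; split => h.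
    by move=> [i _ /Fin]; rewrite /= in_itv/=.
  rewrite /= in_itv/= => /andP[h0 hc].
  have n1 : \forall i \near \oo, a i < h by exact: (cvgr_lt 0 cva).
  have n2 : \forall i \near \oo, a i < c - h by apply: (cvgr_lt 0 cva); rewrite subr_gt0.
  near \oo => i; exists i => //; rewrite /F/= in_itv/=; apply/andP; split.
    by apply/ltW; near: i.
  by rewrite lerBrDl -lerBrDr; apply/ltW; near: i.
have gge0 h : 0 < h < c -> 0 <= g h.
  move=> hc; have [al0 _] := alphaP h hc.
  by rewrite /g mulr_le0// ?dJ_le0// invr_le0 ltW// dchi_lt0.
have mF i : measurable_fun (F i) (EFin \o g).
  apply/measurable_EFinP; apply: subspace_continuous_measurable_fun => //.
  exact: measurable_itv.
have mu_oo : measurable_fun `]0%R, c[%classic (EFin \o g).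
  apply/measurable_EFinP; apply: open_continuous_measurable_fun => //.
  by move=> h; rewrite inE/= in_itv/= => hc; exact: continuous_g.
(* As g is nonnegative, monotone convergence along the growing intervals asks for no bound near the
   ends. *)
have l1 : (\int[mu]_(h in F i) (g h)%:E)%E @[i --> \oo] -->
    (\int[mu]_(h in `]0%R, c[%classic) (g h)%:E)%E.
  have H := @ge0_nondecreasing_set_cvg_integral _ (measurableTypeR R) R F (EFin \o g) mu.
  rewrite -FU; apply: H.
  - apply/nondecreasing_seqP => i; rewrite subsetEset /F; apply: subset_itvScc => //=.
      by rewrite bnd_simp /a ler_pM2l// lef_pV2 ?posrE// ler_nat.
    by rewrite bnd_simp lerB// /a ler_pM2l// lef_pV2 ?posrE// ler_nat.
  - by move=> i; exact: measurable_itv.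
  - exact: mF.
  - by move=> i h /Fin hc; rewrite lee_fin gge0.
(* J is nonincreasing, so its limit along the integers suffices: alpha (a i) exceeds n + 1 as soon
   as a i < chi (n + 1). *)
have la : J (alpha (a i)) @[i --> \oo] --> (0 : R).
  apply/cvgrPdist_lt => e e0.
  have /cvgr_lt/(_ e e0)[n _ /(_ n (leqnn n))/= Jn] := J_cvg0.
  have n1 : \forall i \near \oo, a i < chi n.+1%:R.
    by apply: (cvgr_lt 0 cva); exact: chi_gt0.
  near=> i; rewrite sub0r normrN ger0_norm//.
  have Fa : 0 < a i < c by rewrite (Fin i)// /F/= in_itv/= lexx ltW.
  apply: le_lt_trans Jn; apply: J_le => //; apply: alpha_gt => //.
  by near: i.
have lb : J (alpha (c - a i)) @[i --> \oo] --> J 0.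
  apply: continuous_seq; first exact: (derive_continuous _ _ J'E).
  apply/cvgrPdist_lt => e e0.
  have ce : chi e < c by rewrite -chi0; exact: chi_lt.
  have n1 : \forall i \near \oo, a i < c - chi e.
    by apply: (cvgr_lt 0 cva); rewrite subr_gt0.
  near=> i.
  have Fb : 0 < c - a i < c by rewrite (Fin i)// /F/= in_itv/= lexx ltW ?andbT.
  have [al0 _] := alphaP _ Fb.
  rewrite sub0r normrN gtr0_norm//; apply: alpha_lt => //; first exact: ltW.
  by rewrite ltrBrDl -ltrBrDr; near: i.
have l2 : (\int[mu]_(h in F i) (g h)%:E)%E @[i --> \oo] --> (J 0)%:E.
  under eq_fun do rewrite FTC.
  apply: cvg_EFin; first exact: nearW.
  by rewrite -[X in _ --> X]subr0; apply: cvgB.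
have mf : measurable_fun `]0%R, c[%classic f.
  apply: (eq_measurable_fun g); last exact/measurable_EFinP.
  by move=> h; rewrite inE/= in_itv/= => hc; rewrite fg.
(* f is known only in the open interval; the two endpoints form a null set. *)
rewrite -integral_itv_obnd_cbnd; last first.
  by apply/measurable_EFinP; exact: measurable_fun_itv_oc mf.
rewrite -integral_itv_bndo_bndc; last exact/measurable_EFinP.
transitivity (\int[mu]_(h in `]0%R, c[%classic) (g h)%:E)%E; last first.
  exact: (cvg_unique _ l1 l2).
apply: eq_integral => h.
by rewrite inE/= in_itv/= => hc; rewrite fg.
Unshelve. all: by end_near. Qed.

End AreaUnderInverse.

(** * Entropy of a single channel use *)

Section Channel.
Context {R : realType} (m : nat) (lab : 'rV['F_2]_m -> R * R).
Hypothesis m_gt0 : (0 < m)%N.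
Hypothesis lab_inj : injective lab.

Notation labels := 'rV['F_2]_m.
Let XL (b : labels) (_ : nat) : R * R := lab b.

(* [chi p] is the channel entropy at noise deviation [1 / p]. *)
Definition chi (p : R) : R := Jdiag 1 XL predT p / ((2 ^ m)%:R * ln 2).
Definition dchi (p : R) : R := - (p * Mdiag 1 XL predT p) / ((2 ^ m)%:R * ln 2).

Lemma ln2_gt0 : 0 < ln 2 :> R.
Proof. by rewrite ln_gt0// ltr1n. Qed.

Lemma card_labels : #|[pred b : labels | true]| = (2 ^ m)%N.
Proof. by rewrite (_ : #|_| = #|{: labels}|)// card_mx card_Fp// mul1n. Qed.

Lemma chi_scale_gt0 : 0 < (2 ^ m)%:R * ln 2 :> R.
Proof. by rewrite mulr_gt0 ?ln2_gt0// ltr0n expn_gt0. Qed.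

Lemma iintC1 (F : (nat -> R * R) -> \bar R) (f : R * R -> \bar R) :
  (forall y, F y = f (y 0%N)) -> iintC 1 F = cint f.
Proof. by move=> Ff /=; congr cint; apply/funext => z; rewrite Ff. Qed.

(** A single use is the case N = 1 of the general entropy formula, all labels forming the code and
    each label being its own class. *)
Lemma hchanE (s : R) : 0 < s -> hchan lab s = chi s^-1.
Proof.
move=> s0; rewrite /hchan.
have := iintC_entropy 1 XL labels predT id (fun=> s) (2 ^ m)%:R^-1 (fun=> s0).
cbv zeta; set F := (X in iintC 1 X).
have F1 (b : labels) (y : nat -> R * R) :
    \prod_(t < 1) gauss s (csub (y t) (XL b t)) = gauss s (csub (y 0%N) (lab b)).
  by rewrite big_ord_recl big_ord0 mulr1.
have FE y : F y = ((((2 ^ m)%:R^-1 * (\sum_(b : labels) gauss s (csub (y 0%N) (lab b))) *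
     \sum_(b : labels) negxlog2 (gauss s (csub (y 0%N) (lab b)) /
        \sum_(b' : labels) gauss s (csub (y 0%N) (lab b'))))%:E)).
  rewrite /F; congr EFin.
  have -> : \sum_i \prod_(t < 1) gauss s (csub (y t) (XL i t)) =
      \sum_b gauss s (csub (y 0%N) (lab b)) by apply: eq_bigr => b _; exact: F1.
  congr (_ * _); apply: eq_bigr => b _; congr (negxlog2 (_ / _)).
  by rewrite big_pred1_eq F1.
rewrite [X in _ -> fine X = _](_ : _ = iintC 1 F); last exact/esym/iintC1.
move=> ->.
(* Once the label is known, no uncertainty remains. *)
have -> : Jsum 1 XL predT (fun i j => j == i) (ramp 1 (fun=> s)) = 0.
  rewrite /Jsum big1// => b _.
  apply: iter_gE_cst => v.
  by rewrite /lse /sumexp big_pred1_eq llrxx expR0 ln1.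
rewrite subr0 /= /chi /Jdiag invfM mulrC mulrA; congr (_ * _ * _).
Qed.

Lemma sep_labels (b b' : labels) : predT b -> predT b' -> b != b' ->
  0 < sqdist 1 XL b b'.
Proof.
move=> _ _ bb'; rewrite /sqdist /rpoint /rcoord big_ord_recl big_ord_recl big_ord0/=.
rewrite addr0 /XL lt0r addr_ge0 ?sqr_ge0// andbT paddr_eq0 ?sqr_ge0//.
rewrite !sqrf_eq0 !subr_eq0; apply: contra bb' => /andP[/eqP e2 /eqP e1].
by apply/eqP/lab_inj; move: e1 e2; case: (lab b) (lab b') => [? ?] [? ?] /= -> ->.
Qed.

Lemma is_derive_chi (p : R) : is_derive p (1 : R) chi (dchi p).
Proof.
have h := is_derive_mulf _ _ _ _ _ (is_derive_Jdiag 1 XL predT p)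
  (is_derive_cst ((2 ^ m)%:R * ln 2)^-1 p (1 : R)).
by apply: (is_derive_eq h); rewrite mulr0 addr0.
Qed.

Lemma continuous_dchi : continuous dchi.
Proof.
move=> p; apply: cvgM; last exact: cvg_cst.
by apply: cvgN; apply: cvgM; [exact: cvg_id|exact: continuous_Mdiag].
Qed.

Lemma Mdiag_labels_gt0 p : 0 < Mdiag 1 XL predT p.
Proof.
have [b bn0] : exists b : labels, 0 != b.
  exists (const_mx 1); apply/eqP => /matrixP/(_ ord0 (Ordinal m_gt0)).
  by rewrite !mxE.
exact: (Mdiag_gt0 1 XL predT sep_labels 0 b p).
Qed.

Lemma dchi_lt0 p : 0 < p -> dchi p < 0.
Proof.
move=> p0; rewrite /dchi mulNr oppr_lt0 divr_gt0 ?chi_scale_gt0//.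
by rewrite mulr_gt0// Mdiag_labels_gt0.
Qed.

Lemma chi_ge0 p : 0 <= chi p.
Proof. by rewrite divr_ge0 ?Jdiag_ge0// ltW// chi_scale_gt0. Qed.

Lemma chi0 : chi 0 = m%:R.
Proof.
rewrite /chi Jdiag0 (_ : #|_| = (2 ^ m)%N); last exact: card_labels.
rewrite natrX lnXn// -[ln 2 *+ m]mulr_natr.
have P0 : 2 ^+ m != 0 :> R by rewrite gt_eqF ?exprn_gt0.
have l0 : ln 2 != 0 :> R by rewrite gt_eqF ?ln2_gt0.
by field; rewrite P0 l0.
Qed.

End Channel.

(** * The coded system *)

Section Code.
Context {R : realType} (m N : nat) (C : {vspace 'rV['F_2]_(N * m)}).
Variables (lab : 'rV['F_2]_m -> R * R) (pi : 'S_(N * m)).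
Hypothesis N_gt0 : (0 < N)%N.
Hypothesis lab_inj : injective lab.

Notation words := 'rV['F_2]_(N * m).
Let Q : pred words := [pred c | c \in C].
Let bits (t : 'I_N) (c : words) : 'rV['F_2]_m := row t (vec_mx (col_perm pi c)).
Let XC (c : words) (n : nat) : R * R :=
  if insub n is Some t then xsym lab pi t c else (0, 0).
(** The default 1 keeps the deviation positive at every index, as [iintC_entropy] requires. *)
Let ext (s : 'I_N -> R) (n : nat) : R := if insub n is Some t then s t else 1.
(* Codewords sharing symbol t are indistinguishable in the coordinates of that
   symbol, so their sum does not depend on the noise level of symbol t. *)
Let P (t : 'I_N) (c c' : words) := Q c' && (bits t c' == bits t c).

(** The chain rule H(X_t|Y) = H(X|Y) - H(X|X_t, Y). Injectivity of the labeling turns equality of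
    symbols into equality of their m bits. *)
Lemma HsymE (s : 'I_N -> R) (t : 'I_N) : (forall t, 0 < s t) ->
  Hsym C lab pi s t = #|Q|%:R^-1 / ln 2 *
    (Jsum N XC Q (fun=> Q) (ramp N (ext s)) - Jsum N XC Q (P t) (ramp N (ext s))).
Proof.
move=> s0.
have es0 n : 0 < ext s n by rewrite /ext; case: insubP.
have := iintC_entropy N XC _ Q (bits t) (ext s) (#|Q|%:R^-1) es0.
rewrite /= => E; rewrite /Hsym.
rewrite (_ : iintC N _ = (#|Q|%:R^-1 / ln 2 *
    (Jsum N XC Q (fun=> Q) (ramp N (ext s)) - Jsum N XC Q (P t) (ramp N (ext s))))%:E)//.
rewrite -E; congr iintC; apply/funext => y; congr EFin.
have likE c : lik lab pi s c y = \prod_(t < N) gauss (ext s t) (csub (y t) (XC c t)).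
  by apply: eq_bigr => u _; rewrite /ext /XC valK.
have lsE : liksum C lab pi s y =
    \sum_(c | Q c) \prod_(t < N) gauss (ext s t) (csub (y t) (XC c t)).
  by apply: eq_bigr => c _; exact: likE.
rewrite /pY lsE; congr (_ * _); apply: eq_bigr => b _; rewrite /post lsE.
congr (negxlog2 (_ / _)); apply: eq_big => [c|c _]; last exact: likE.
by rewrite /xsym (inj_eq lab_inj).
Qed.

Lemma symidx_ltN k : (symidx N k < N)%N.
Proof. by rewrite /symidx ltn_subrL. Qed.

Lemma Emse_same_symbol (t : 'I_N) a c k : symidx N k = t -> Q c ->
  Emse N XC (P t c) a c k = 0.
Proof.
move=> kt Qc.
apply: iter_gE_cst => v.
rewrite /mse /softmean big1 ?expr0n// => c' /andP[_ /eqP E].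
suff -> : rpoint N XC c k = rpoint N XC c' k by rewrite subrr mulr0.
have -> : rpoint N XC c k = rpoint N XC c' k; last by [].
by rewrite /rpoint /rcoord kt /XC valK /xsym -!/(bits t _) E.
Qed.

Variables (alpha : R -> R) (dalpha h : R).
Hypothesis dalphaE : is_derive h (1 : R) alpha dalpha.

(** [lam] marks the real coordinates of symbol t and [kap] freezes the others at [alpha h]. The
    subtracted entropy has derivative 0, because codewords sharing symbol t agree in the moving
    coordinates. *)
Lemma is_derive_Hsym (sig : R -> R) (t : 'I_N) :
  (\forall u \near h, 0 < sig u) -> alpha = (fun u => (sig u)^-1) ->
  is_derive h (1 : R)
    (fun u => Hsym C lab pi (fun s => if s == t then sig u else sig h) t)
    (#|Q|%:R^-1 / ln 2 * (- (\sum_(c | Q c) \sum_(k < N.*2)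
       (symidx N k == t)%:R * alpha h * Emse N XC Q (fun=> alpha h) c k) * dalpha)).
Proof.
move=> sig0 alphaE.
have sh0 : 0 < sig h := nbhs_singleton sig0.
pose lam k : R := (symidx N k == t)%:R.
pose kap k : R := (1 - lam k) * alpha h.
have rampE u : ramp N (ext (fun s => if s == t then sig u else sig h)) =
    (fun k => kap k + lam k * alpha u).
  apply/funext => k; rewrite /ramp /ext insubT ?symidx_ltN// => lt.
  rewrite /kap /lam -[Sub _ _ == t](inj_eq val_inj)/= alphaE.
  by case: eqP => _; rewrite ?subrr ?subr0 ?mul0r ?mul1r ?add0r ?addr0.
have aE : (fun k => kap k + lam k * alpha h) = (fun=> alpha h).
  by apply/funext => k; rewrite /kap -mulrDl subrK mul1r.
pose A := is_derive_compf _ _ _ _ _ dalphaE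
  (is_derive_Jsum N XC Q (fun=> Q) kap lam (alpha h) (fun c Qc => Qc)).
have PP c : Q c -> P t c c by move=> Qc; rewrite /P Qc eqxx.
pose B := is_derive_compf _ _ _ _ _ dalphaE
  (is_derive_Jsum N XC Q (P t) kap lam (alpha h) PP).
have AB := is_derive_mulf _ _ _ _ _ (is_derive_cst (#|Q|%:R^-1 / ln 2) h (1 : R))
  (is_derive_addf _ _ _ _ _ A (is_deriveN B)).
have near_eq : \forall u \near h,
    #|Q|%:R^-1 / ln 2 * (Jsum N XC Q (fun=> Q) (fun k => kap k + lam k * alpha u) -
       Jsum N XC Q (P t) (fun k => kap k + lam k * alpha u)) =
    Hsym C lab pi (fun s => if s == t then sig u else sig h) t.
  near=> u.
  rewrite HsymE ?rampE// => s; case: ifP => // _.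
  by near: u.
apply: (near_eq_is_derive near_eq).
apply: (is_derive_eq AB).
rewrite mul0r add0r /= !aE; congr (_ * _).
rewrite [X in - (X * _)](_ : _ = 0); last first.
  apply/eqP; rewrite oppr_eq0; apply/eqP; rewrite big1// => c Qc.
  rewrite big1// => k _; rewrite /lam; have [kt|_] := eqVneq (symidx N k) t.
    by rewrite Emse_same_symbol// mulr0.
  by rewrite !mul0r.
rewrite mul0r subr0; congr (- _ * _).
apply: eq_bigr => c _; apply: eq_bigr => k _; congr (_ * _ * _).
by have := congr1 (fun f => f (k : nat)) aE.
Unshelve. all: by end_near. Qed.

(** Each of the 2N real coordinates belongs to exactly one symbol, so the partial derivatives add up
    to the diagonal one. *)
Lemma gexitE (sig : R -> R) :
  (\forall u \near h, 0 < sig u) -> alpha = (fun u => (sig u)^-1) ->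
  gexit C lab pi sig h = N%:R^-1 * (#|Q|%:R^-1 / ln 2) *
    (- (alpha h * Mdiag N XC Q (alpha h)) * dalpha).
Proof.
move=> sig0 alphaE; rewrite /gexit -mulrA; congr (_ * _).
under eq_bigr => t _.
  rewrite derive1E (@derive_val _ _ _ _ _ _ _ (is_derive_Hsym sig t sig0 alphaE)).
  over.
rewrite -mulr_sumr; congr (_ * _); rewrite -mulr_suml; congr (_ * _).
rewrite sumrN; congr (- _); rewrite exchange_big/= /Mdiag mulr_sumr.
apply: eq_bigr => c _; rewrite exchange_big/= mulr_sumr; apply: eq_bigr => k _.
rewrite -!mulr_suml (bigD1 (Ordinal (symidx_ltN k)))//= eqxx big1 ?addr0 ?mul1r// => t.
by rewrite -(inj_eq val_inj)/= eq_sym => /negbTE ->.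
Qed.

(** The real coordinates determine the symbols, the injective labeling gives back the bits, and the
    interleaver is a permutation. *)
Lemma sep_code c c' : Q c -> Q c' -> c != c' -> 0 < sqdist N XC c c'.
Proof.
move=> _ _ cc'; rewrite lt0r sumr_ge0 ?andbT; last by move=> *; exact: sqr_ge0.
apply: contra cc' => /eqP S0; apply/eqP.
have D0 (k : nat) : (k < N.*2)%N -> rpoint N XC c k = rpoint N XC c' k.
  move=> kN; apply/eqP; rewrite -subr_eq0 -sqrf_eq0.
  move/eqP: S0; rewrite psumr_eq0; last by move=> *; exact: sqr_ge0.
  by move=> /allP/(_ (Ordinal kN) (mem_index_enum _)).
have xE (t : 'I_N) : xsym lab pi t c = xsym lab pi t c'.
  (* [symidx] reverses the order of the symbols, so t is found at its position counted from the
     end. *)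
  pose k := (N - t.+1)%N.
  have kN : (k < N)%N by rewrite /k ltn_subrL.
  have kt : (N - k.+1)%N = t by rewrite /k -subSn// subSS subKn// ltnW.
  have e2 : rpoint N XC c k.*2 = rpoint N XC c' k.*2.
    by apply: D0; rewrite ltn_double.
  have e1 : rpoint N XC c k.*2.+1 = rpoint N XC c' k.*2.+1.
    by apply: D0; rewrite ltn_Sdouble.
  move: e1 e2; rewrite /rpoint /rcoord /symidx /= odd_double/= uphalf_double doubleK kt.
  rewrite /XC valK; case: (xsym _ _ _ c) => [? ?]; case: (xsym _ _ _ c') => [? ?].
  by move=> /= -> ->.
have bE (t : 'I_N) : bits t c = bits t c' by exact/lab_inj/xE.
have vE : vec_mx (col_perm pi c) = vec_mx (col_perm pi c').
  by apply/row_matrixP => t; exact: bE.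
have /matrixP pE := can_inj vec_mxK vE.
apply/matrixP => i j; have := pE i (pi^-1 j)%g.
by rewrite !mxE permKV.
Qed.

Lemma is_derive_Jcode (x p : R) : is_derive p (1 : R)
  (fun p => x * Jdiag N XC Q p) (x * - (p * Mdiag N XC Q p)).
Proof.
have H := is_derive_mulf _ _ _ _ _ (is_derive_cst x p (1 : R))
  (is_derive_Jdiag N XC Q p).
by apply: (is_derive_eq H); rewrite mul0r add0r.
Qed.

End Code.

Theorem theorem2 (R : realType) (m N k : nat)
  (C : {vspace 'rV['F_2]_(N * m)}) (lab : 'rV['F_2]_m -> R * R)
  (pi : 'S_(N * m)) (sig : R -> R) :
  (0 < m)%N -> (0 < N)%N ->
  \dim C = k ->
  injective lab ->
  (forall h : R, 0 < h < m%:R -> 0 < sig h /\ hchan lab (sig h) = h) ->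
  ((m%:R)^-1%:E *
     \int[@lebesgue_measure R]_(h in `[0%R, (m%:R : R)]%classic) (gexit C lab pi sig h)%:E)%E
  = (k%:R / (N * m)%:R)%:E.
Proof.
move=> m0 N0 dimC lab_inj sigP.
pose alpha (h : R) : R := (sig h)^-1.
pose Q : pred 'rV['F_2]_(N * m) := [pred c | c \in C].
have cardQ : #|Q| = (2 ^ k)%N by rewrite card_vspace dimC card_Fp.
(* This turns the sum over codewords, in nats, into H(X|Y) / N in bits. *)
pose kappa : R := N%:R^-1 * (#|Q|%:R^-1 / ln 2).
have kappa0 : 0 <= kappa.
  by rewrite mulr_ge0 ?invr_ge0// mulr_ge0 ?invr_ge0// ltW// ln2_gt0.
pose XC (c : 'rV['F_2]_(N * m)) (n : nat) : R * R :=
  if insub n is Some t then xsym lab pi t c else (0, 0).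
have alphaP (h : R) : 0 < h < m%:R -> 0 < alpha h /\ chi m lab (alpha h) = h.
  move=> hm; have [s0 sE] := sigP h hm; rewrite /alpha invr_gt0; split=> //.
  by rewrite -hchanE.
have J'E := is_derive_Jcode m N C lab pi kappa.
have chi'E := is_derive_chi m lab.
have cdJ : continuous (fun p : R => kappa * - (p * Mdiag N XC Q p)).
  move=> p; apply: cvgM; first exact: cvg_cst.
  by apply: cvgN; apply: cvgM; [exact: cvg_id|exact: continuous_Mdiag].
have dJ_le0 (p : R) : 0 < p -> kappa * - (p * Mdiag N XC Q p) <= 0.
  by move=> p0; rewrite mulrN oppr_le0 mulr_ge0// mulr_ge0 ?(ltW p0) ?Mdiag_ge0.
have J_ge0 (p : R) : 0 <= kappa * Jdiag N XC Q p.
  by rewrite mulr_ge0// Jdiag_ge0.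
have J_cvg0 : kappa * Jdiag N XC Q n.+1%:R @[n --> \oo] --> (0 : R).
  rewrite -[X in _ --> X](mulr0 kappa); apply: cvgM; first exact: cvg_cst.
  apply: Jdiag_cvg0 => c c'; exact: sep_code.
have gE' (h : R) : 0 < h < m%:R -> gexit C lab pi sig h =
    kappa * - (alpha h * Mdiag N XC Q (alpha h)) / dchi m lab (alpha h).
  move=> hm.
  have near_m : \forall u \near h, 0 < u < m%:R.
    by apply: near_in_itvoo; rewrite in_itv/=.
  have sig0 : \forall u \near h, 0 < sig u.
    by near=> u; have [] := sigP u; [near: u|].
  have dal := is_derive_alpha (chi m lab) (dchi m lab) alpha m%:R chi'E
    (dchi_lt0 m lab m0 lab_inj) alphaP h hm.
  rewrite (gexitE m N C lab pi N0 lab_inj alpha _ h dal sig sig0 erefl).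
  exact: mulrA.
rewrite (integral_derive_inverse (fun p => kappa * Jdiag N XC Q p) (chi m lab)
  (fun p => kappa * - (p * Mdiag N XC Q p)) (dchi m lab) alpha m%:R)//; last 5 first.
- by rewrite ltr0n.
- exact: continuous_dchi.
- exact: dchi_lt0.
- exact: chi0.
- exact: chi_ge0.
(* At amplitude 0 the 2^k codewords are equally likely, and kappa times 2^k ln(2^k) is k / N. *)
rewrite Jdiag0 cardQ -EFinM; congr EFin.
rewrite /kappa cardQ natrX lnXn// -[ln 2 *+ k]mulr_natr natrM.
have P0 : 2 ^+ k != 0 :> R by rewrite gt_eqF ?exprn_gt0.
have l0 : ln 2 != 0 :> R by rewrite gt_eqF ?ln2_gt0.
have N0' : N%:R != 0 :> R by rewrite pnatr_eq0 -lt0n.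
have m0' : m%:R != 0 :> R by rewrite pnatr_eq0 -lt0n.
by field; rewrite P0 l0 N0' m0'.
Unshelve. all: by end_near. Qed.
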